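(* Let $0\le\lambda\le1$ and let $\varphi$ be as described in the context, with $\varphi(z)=1+B_1z+B_2z^2+\cdots$. If $f(z)=z+\sum_{n\ge2}a_nz^n$ belongs to the class $\mathcal{G}^{\lambda}_{\sigma}(\varphi)$, then \[ |a_2|\le \frac{B_1\sqrt{B_1}}{\sqrt{4B_1+|(3-\lambda)B_1^2-4B_2|}} \] and \[ |a_3|\le\begin{cases}\left(1-\dfrac{4}{3(1+\lambda)B_1}\right)\dfrac{B_1^3}{4B_1+|(3-\lambda)B_1^2-4B_2|}+\dfrac{B_1}{3(1+\lambda)}, & \text{if } B_1\ge \dfrac{4}{3(1+\lambda)},\\[3mm] \dfrac{B_1}{3(1+\lambda)}, & \text{if } B_1< \dfrac{4}{3(1+\lambda)}.\end{cases} \]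
   Context: $\mathbb{U}=\{z\in\mathbb{C}:|z|<1\}$. For analytic $f,g$ on $\mathbb{U}$, $f\prec g$ (subordination) means there is an analytic $w$ on $\mathbb{U}$ with $w(0)=0$, $|w(z)|<1$, and $f(z)=g(w(z))$. The function $\varphi$ is analytic and univalent in $\mathbb{U}$ with positive real part, $\varphi(0)=1$, $\varphi'(0)>0$, $\varphi$ maps $\mathbb{U}$ onto a region starlike with respect to $1$ and symmetric with respect to the real axis; its expansion is $\varphi(z)=1+B_1z+B_2z^2+B_3z^3+\cdots$ with all coefficients real and $B_1>0$. $\sigma$ denotes the class of bi-univalent functions: analytic functions $f(z)=z+\sum_{n\ge2}a_nz^n$ on $\mathbb{U}$ that are univalent in $\mathbb{U}$ and whose inverse $g=f^{-1}$, $g(w)=w-a_2w^2+(2a_2^2-a_3)w^3-(5a_2^3-5a_2a_3+a_4)w^4+\cdots$, is also univalent in $\mathbb{U}$ (i.e. extends univalently to $\mathbb{U}$). For $0\le\lambda\le1$, $\mathcal{G}^{\lambda}_{\sigma}(\varphi)$ is the set of $f\in\sigma$ such that $(1-\lambda)f'(z)+\lambda\left(1+\frac{zf''(z)}{f'(z)}\right)\prec\varphi(z)$ for $z\in\mathbb{U}$ and $(1-\lambda)g'(w)+\lambda\left(1+\frac{wg''(w)}{g'(w)}\right)\prec\varphi(w)$ for $w\in\mathbb{U}$, where $g=f^{-1}$. *)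

(* Defs.v *)
(* MathComp-Analysis over the complex field R[i], R : realType. *)
From HB Require Import structures.
From mathcomp Require Import all_boot all_order all_algebra.
From mathcomp Require Import all_classical all_reals all_analysis.
From mathcomp Require Import complex.
Set Implicit Arguments. Unset Strict Implicit. Unset Printing Implicit Defensive.
Import Order.TTheory GRing.Theory Num.Theory.
Import numFieldNormedType.Exports.
Local Open Scope ring_scope.
Local Open Scope classical_set_scope.
Local Open Scope complex_scope.

Section Defs.
Variable R : realType.
Local Notation C := (R[i])^o.

(* C is the complex plane R[i], viewed as a normed space over itself (^o) *)

(* the open unit disk U *)
Definition inU (z : C) : Prop := `|z| < 1.

(* analytic (holomorphic) in U: complex differentiable at every point of U *)
Definition analytic_U (f : C -> C) : Prop := forall z, inU z -> derivable f z 1.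

(* univalent in U: analytic and injective on U *)
Definition univalent_U (f : C -> C) : Prop :=
  analytic_U f /\ forall z1 z2, inU z1 -> inU z2 -> f z1 = f z2 -> z1 = z2.

(* subordination h ≺ F in U *)
Definition subord (h F : C -> C) : Prop :=
  exists w : C -> C, [/\ analytic_U w, w 0 = 0, (forall z, inU z -> inU (w z))
                      & forall z, inU z -> h z = F (w z)].

(* the power series sum_n c_n z^n converges to v *)
Definition has_series (c : nat -> C) (z v : C) : Prop :=
  (fun n => \sum_(0 <= k < n) c k * z ^+ k) @ \oo --> v.

(* hypotheses on phi, with Taylor coefficients B (real) *)
Definition phi_hyp (phi : C -> C) (B : nat -> R) : Prop :=
  [/\ [/\ univalent_U phi,
      (forall z, inU z -> 0 < 'Re (phi z)),
      phi 0 = 1 &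
      0 < derive1 phi 0],
      (* phi(U) starlike with respect to 1 *)
      (forall z t, inU z -> 0 <= t <= 1 ->
         exists2 u, inU u & phi u = 1 + t%:C * (phi z - 1)),
      (* phi(U) symmetric with respect to the real axis *)
      (forall z, inU z -> exists2 u, inU u & phi u = (phi z)^*) &
      [/\ (forall z, inU z -> has_series (fun n => (B n)%:C) z (phi z)),
          B 0%N = 1 & 0 < B 1%N]].

(* g is the univalent extension to U of the inverse of f *)
Definition inverse_ext (f g : C -> C) : Prop :=
  univalent_U g /\ \forall z \near (0 : C), g (f z) = z.

(* the class sigma of bi-univalent functions (normalized f(0)=0, f'(0)=1) *)
Definition bi_univalent (f : C -> C) : Prop :=
  [/\ univalent_U f, f 0 = 0, derive1 f 0 = 1 & exists g, inverse_ext f g].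

(* (1-lam) h'(z) + lam (1 + z h''(z)/h'(z)) *)
Definition Gop (lam : R) (h : C -> C) (z : C) : C :=
  (1 - lam%:C) * derive1 h z + lam%:C * (1 + z * derive1 (derive1 h) z / derive1 h z).

(* the class G^lam_sigma(phi) *)
Definition G_class (lam : R) (phi : C -> C) (f : C -> C) : Prop :=
  bi_univalent f /\
  exists g, [/\ inverse_ext f g, subord (Gop lam f) phi & subord (Gop lam g) phi].

End Defs.

(* Main.v *)
Require Import Defs.
From HB Require Import structures.
From mathcomp Require Import all_boot all_order all_algebra.
From mathcomp Require Import all_classical all_reals all_analysis.
From mathcomp Require Import complex.
From mathcomp Require Import ring lra zify.
Import Order.TTheory GRing.Theory Num.Theory.
Import numFieldNormedType.Exports.
Import Normc.
Local Open Scope ring_scope.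
Local Open Scope complex_scope.

(** Write [Gop lam f = phi o u] and [Gop lam g = phi o v].  Comparing second order
    expansions at 0 (with those of [g] coming from [f (g w) = w]) expresses [a_2],
    [a_3] through the coefficients of [u] and [v], and the bounds follow from
    [|b_2| <= 1 - |b_1|^2] for a Schwarz function [b_1 z + b_2 z^2 + ...].

    Since [u] and [v] are only known to be complex differentiable, this inequality
    needs a form of Cauchy's theorem: pulling a function on the punctured disc back
    by [exp] and applying Goursat's bisection to rectangles [x1, L] x [0, 2 pi], whose
    horizontal sides cancel, shows that [Re F <= 0] on [|z| = r] implies [Re F(0) <= 0].
    It is applied to the holomorphic function whose real part on the circle is
    [2 Re (X conj(Y)) - |1 + beta z|^2 - |Y|^2], where [X = w (1 + beta z)],
    [Y = z (b_1 + e z)], [beta = conj(b_1) e] and [e = b_2 / |b_2|]. *)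

(** * Goursat's lemma on rectangles *)

Lemma mean_value_closed {R : realType} {F f : R -> R} {a b : R} : a <= b ->
  (forall x, a <= x <= b -> is_derive x 1 F (f x)) ->
  exists2 c, a <= c <= b & F b - F a = f c * (b - a).
Proof.
move=> ab dF.
have [||c cab ->] := @MVT_segment R F f a b ab.
- by move=> x; rewrite in_itv/= => /andP[ax xb]; apply: dF; rewrite !ltW.
- apply: derivable_within_continuous => x; rewrite in_itv/= => xab.
  by have [] := dF _ xab.
- by exists c.
Qed.

(** The primitive is the Lebesgue integral from [a]. Its two-sided derivative is claimed only at
    interior points, so users take an interval slightly larger than the one they work on. *)
Lemma antiderivative_exists {R : realType} {h : R -> R} {a b : R} : a < b ->
  (forall x, a <= x <= b -> {for x, continuous h}) ->
  exists H : R -> R, forall x, a < x < b -> is_derive x 1 H (h x).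
Proof.
move=> ab ch.
have ih : (@lebesgue_measure R).-integrable `[a, b]%classic (EFin \o h).
  apply: continuous_compact_integrable; first exact: segment_compact.
  apply: continuous_in_subspaceT => x; rewrite inE/= in_itv/=; exact: ch.
exists (fun x => \int[lebesgue_measure]_(t in `[a, x]) (h t))%R => x /andP[ax xb].
have [|dF F'] := continuous_FTC1_closed xb ih ax.
  by apply: ch; rewrite !ltW.
by rewrite -F' derive1E; apply: derivableP.
Qed.

(** Every left end lies below every right end, so the supremum of the left ends belongs to all the
    intervals. *)
Lemma nested_point {R : realType} (u h : nat -> R) :
  (forall n, u n <= u n.+1) -> (forall n, u n.+1 + h n.+1 <= u n + h n) ->
  (forall n, 0 <= h n) -> exists c, forall n, u n <= c <= u n + h n.
Proof.
move=> u1 u2 h0.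
have um m n : (m <= n)%N -> u m <= u n /\ u n + h n <= u m + h m.
  elim: n => [|n IH]; first by rewrite leqn0 => /eqP ->.
  rewrite leq_eqVlt => /predU1P[->//|]; rewrite ltnS => /IH[a b].
  by split; [apply: le_trans a _|apply: le_trans b].
have ub m n : u m <= u n + h n.
  case: (leqP m n) => [/um[a _]|/ltnW/um[_ a]].
    by apply: le_trans a _; rewrite lerDl.
  by apply: le_trans a; rewrite lerDl.
exists (sup (range u)) => n; apply/andP; split.
  apply: ub_le_sup; last by exists n.
  by exists (u 0%N + h 0%N) => _ [m _ <-].
apply: ge_sup; first by exists (u 0%N), 0%N.
by move=> _ [m _ <-].
Qed.

Section goursat.
Context {R : realType}.

(* The imaginary part of the integral of [p + i q] along the boundary of
   [x1, x2] x [y1, y2], in terms of antiderivatives [P x] of [p x] and [Q ^~ y] of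
   [q ^~ y]. *)
Definition boundary_int (P Q : R -> R -> R) (x1 x2 y1 y2 : R) : R :=
  (P x2 y2 - P x2 y1) - (P x1 y2 - P x1 y1)
  + (Q x2 y1 - Q x1 y1) - (Q x2 y2 - Q x1 y2).

Variables (p q P Q : R -> R -> R) (x1 x2 y1 y2 : R).
Hypotheses (x12 : x1 <= x2) (y12 : y1 <= y2).
Let box x y := (x1 <= x <= x2) && (y1 <= y <= y2).
Hypothesis dP : forall x y, box x y -> is_derive y 1 (P x) (p x y).
Hypothesis dQ : forall x y, box x y -> is_derive x 1 (Q ^~ y) (q x y).
(** Complex differentiability of [p + i q] within the box, in real coordinates: the derivative at
    the point is [a + i b]. *)
Hypothesis cauchy_riemann : forall x0 y0, box x0 y0 -> exists a b : R,
  forall e : R, 0 < e -> exists2 d : R, 0 < d & forall x y, box x y ->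
    `|x - x0| <= d -> `|y - y0| <= d ->
    `|p x y - p x0 y0 - (a * (x - x0) - b * (y - y0))| <= e * (`|x - x0| + `|y - y0|) /\
    `|q x y - q x0 y0 - (b * (x - x0) + a * (y - y0))| <= e * (`|x - x0| + `|y - y0|).

(** A box of generation [n] is stored by its lower left corner alone, since [n] bisections leave
    sides of known length. *)
Let side n (a b : R) := (b - a) / 2 ^+ n.
Let J n (z : R * R) :=
  boundary_int P Q z.1 (z.1 + side n x1 x2) z.2 (z.2 + side n y1 y2).

Lemma side0 a b : side 0 a b = b - a. Proof. by rewrite /side expr0 divr1. Qed.
Lemma sideS n a b : side n a b = side n.+1 a b + side n.+1 a b.
Proof. rewrite /side exprS; field; by rewrite expf_neq0. Qed.
Lemma side_ge0 n a b : a <= b -> 0 <= side n a b.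
Proof. by move=> ab; rewrite divr_ge0 ?exprn_ge0 ?subr_ge0. Qed.

(** Integrals along the inner edges cancel, so the four quarters add up to the whole and one of them
    carries at least a fourth of it. *)
Lemma quarter_box n z : exists z' : R * R,
  [/\ z.1 <= z'.1, z'.1 + side n.+1 x1 x2 <= z.1 + side n x1 x2,
      z.2 <= z'.2, z'.2 + side n.+1 y1 y2 <= z.2 + side n y1 y2 &
      `|J n z| <= 4 * `|J n.+1 z'|].
Proof.
have hx := side_ge0 n.+1 _ _ x12; have hy := side_ge0 n.+1 _ _ y12.
have Sx := sideS n x1 x2; have Sy := sideS n y1 y2.
set h := side n.+1 x1 x2 in hx Sx *; set k := side n.+1 y1 y2 in hy Sy *.
pose z2 := (z.1 + h, z.2); pose z3 := (z.1, z.2 + k).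
pose z4 := (z.1 + h, z.2 + k).
have E : J n z = J n.+1 z + J n.+1 z2 + J n.+1 z3 + J n.+1 z4.
  rewrite /J /boundary_int /= Sx Sy -/h -/k !addrA; ring.
have T : `|J n z| <= `|J n.+1 z| + `|J n.+1 z2| + `|J n.+1 z3| + `|J n.+1 z4|.
  rewrite E; apply: le_trans (ler_normD _ _) _; rewrite lerD2r.
  by apply: le_trans (ler_normD _ _) _; rewrite lerD2r; apply: ler_normD.
have [c1|c1] := leP `|J n z| (4 * `|J n.+1 z|).
  by exists z; split => //; lra.
have [c2|c2] := leP `|J n z| (4 * `|J n.+1 z2|).
  by exists z2; rewrite /z2; split => //=; lra.
have [c3|c3] := leP `|J n z| (4 * `|J n.+1 z3|).
  by exists z3; rewrite /z3; split => //=; lra.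
by exists z4; rewrite /z4; split => //=; lra.
Qed.

(** The successive quarters shrink to a point. Near it [p + i q] is affine up to a relative error
    [e], and the affine part contributes nothing to the boundary integral. *)
Lemma small_box (e : R) : 0 < e -> exists n z,
  `|J 0 (x1, y1)| <= 4 ^+ n * `|J n z| /\
  `|J n z| <= 2 * e * (side n x1 x2 + side n y1 y2) ^+ 2.
Proof.
move=> e0.
(* Choice turns the existence of a good quarter into a function; iterating it gives the nested
   corners [z n]. *)
have [F HF] := choice (fun nz : nat * (R * R) => quarter_box nz.1 nz.2).
pose z := fix z n := if n is m.+1 then F (m, z m) else (x1, y1).
have Hz n := HF (n, z n).
have hx n : 0 <= side n x1 x2 by apply: side_ge0.
have hy n : 0 <= side n y1 y2 by apply: side_ge0.
have [||x0 Hx] := nested_point (fun n => (z n).1) (side ^~ x1 ^~ x2) _ _ hx.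
- by move=> n; have [] := Hz n.
- by move=> n; have [] := Hz n.
have [||y0 Hy] := nested_point (fun n => (z n).2) (side ^~ y1 ^~ y2) _ _ hy.
- by move=> n; have [] := Hz n.
- by move=> n; have [] := Hz n.
have inbox n : [/\ x1 <= (z n).1, (z n).1 + side n x1 x2 <= x2,
                  y1 <= (z n).2 & (z n).2 + side n y1 y2 <= y2].
  elim: n => [|n [a b c d]]; first by rewrite !side0 /=; split => //; lra.
  by have [a' b' c' d' _] := Hz n; split => /=; lra.
have Jz n : `|J 0 (x1, y1)| <= 4 ^+ n * `|J n (z n)|.
  elim: n => [|n IH]; first by rewrite expr0 mul1r.
  apply: le_trans IH _; rewrite exprSr -mulrA ler_wpM2l ?exprn_ge0//.
  by have [] := Hz n.
have b0 : box x0 y0.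
  have := Hx 0%N; have := Hy 0%N; have [] := inbox 0%N; rewrite /box !side0 /=.
  lra.
have [a [b /(_ _ e0)[d d0 CR]]] := cauchy_riemann _ _ b0.
have [n nd] : exists n, (x2 - x1) + (y2 - y1) <= d * 2 ^+ n.
  exists (Num.truncn (((x2 - x1) + (y2 - y1)) / d)).+1.
  rewrite mulrC -ler_pdivrMr//.
  apply: le_trans (ltW (truncnS_gt _)) _.
  by rewrite -natrX ler_nat ltnW// ltn_expl.
exists n, (z n); split => //.
have [i1 i2 i3 i4] := inbox n; have [/andP[k1 k2] /andP[l1 l2]] := (Hx n, Hy n).
have sd : side n x1 x2 + side n y1 y2 <= d.
  by rewrite -mulrDl ler_pdivrMr// exprn_gt0.
move: (hx n) (hy n) => hn kn.
rewrite /J /boundary_int.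
move: (z n) i1 i2 i3 i4 k1 k2 l1 l2 => [X Y] /=.
move: hn kn sd.
set h := side n x1 x2; set k := side n y1 y2 => hn kn sd i1 i2 i3 i4 k1 k2 l1 l2.
(* The mean value theorem is applied to the difference of the two vertical sides, so that both are
   evaluated at the same height [et]; likewise for the horizontal sides at [xi]. *)
have [||et /andP[e1 e2] Ee] := @mean_value_closed R (P (X + h) \- P X)
   (fun y => p (X + h) y - p X y) Y (Y + k).
- by lra.
- move=> y Hy'; apply: is_deriveB; apply: dP; rewrite /box; lra.
have [||xi /andP[x3 x4] Ex] := @mean_value_closed R (fun x => Q x Y - Q x (Y + k))
   (fun x => q x Y - q x (Y + k)) X (X + h).
- by lra.
- move=> x Hx'; apply: is_deriveB; apply: dQ; rewrite /box; lra.
have -> : P (X + h) (Y + k) - P (X + h) Y - (P X (Y + k) - P X Y) +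
   (Q (X + h) Y - Q X Y) - (Q (X + h) (Y + k) - Q X (Y + k)) =
   ((p (X + h) et - p X et) * k + (q xi Y - q xi (Y + k)) * h).
  move: Ee Ex => /=; rewrite !(addrC _ h) !(addrC _ k) !addrK => <- <-; ring.
have B (s t : R) : X <= s <= X + h -> Y <= t <= Y + k ->
   box s t /\ `|s - x0| + `|t - y0| <= h + k /\ `|s - x0| <= d /\ `|t - y0| <= d.
  move=> Hs Ht.
  have A1 : `|s - x0| <= h by rewrite ler_norml; lra.
  have A2 : `|t - y0| <= k by rewrite ler_norml; lra.
  by rewrite /box; split; [|split; [|split]]; lra.
have CR' s t : X <= s <= X + h -> Y <= t <= Y + k ->
    `|p s t - p x0 y0 - (a * (s - x0) - b * (t - y0))| <= e * (h + k) /\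
    `|q s t - q x0 y0 - (b * (s - x0) + a * (t - y0))| <= e * (h + k).
  move=> Hs Ht; have [b1 [b2 [b3 b4]]] := B _ _ Hs Ht.
  have [c1 c2] := CR _ _ b1 b3 b4.
  by split; [apply: le_trans c1 _|apply: le_trans c2 _]; rewrite ler_wpM2l // ltW.
have [r1 _] := CR' (X + h) et ltac:(lra) ltac:(lra).
have [r2 _] := CR' X et ltac:(lra) ltac:(lra).
have [_ r3] := CR' xi Y ltac:(lra) ltac:(lra).
have [_ r4] := CR' xi (Y + k) ltac:(lra) ltac:(lra).
(* With a common second coordinate the [b] terms cancel, leaving [a * h]; the horizontal sides leave
   [- a * k]. Weighted by [k] and [h], these two contributions are opposite. *)
have T1 : `|p (X + h) et - p X et - a * h| <= 2 * e * (h + k).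
  by move: r1 r2; rewrite !ler_norml; lra.
have T2 : `|q xi Y - q xi (Y + k) + a * k| <= 2 * e * (h + k).
  by move: r3 r4; rewrite !ler_norml; lra.
have -> : (p (X + h) et - p X et) * k + (q xi Y - q xi (Y + k)) * h =
  (p (X + h) et - p X et - a * h) * k + (q xi Y - q xi (Y + k) + a * k) * h.
  ring.
have M (u v m : R) : 0 <= v -> `|u| <= m -> `|u * v| <= m * v.
  by move=> v0 um; rewrite normrM (ger0_norm v0) ler_wpM2r.
apply: le_trans (ler_normD _ _) (le_trans (lerD (M _ _ _ kn T1) (M _ _ _ hn T2)) _).
by rewrite -mulrDr (addrC k) expr2 mulrA.
Qed.

Lemma goursat : boundary_int P Q x1 x2 y1 y2 = 0.
Proof.
have J0 : boundary_int P Q x1 x2 y1 y2 = J 0 (x1, y1).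
  by rewrite /J !side0 /= !(addrC _ (_ - _)) !subrK.
apply/eqP; rewrite J0 -normr_le0; apply/ler_addgt0Pl => e e0; rewrite addr0.
pose s := (x2 - x1 + (y2 - y1)).
have s0 : 0 <= s by rewrite addr_ge0 ?subr_ge0.
(* The factors [4 ^+ n] and [(s / 2 ^+ n) ^+ 2] balance for every [n], leaving a multiple of
   [s ^+ 2]; the added 1 covers a degenerate rectangle. *)
have e'0 : 0 < e / (2 * (s ^+ 2 + 1)).
  by rewrite divr_gt0// mulr_gt0// ltr_wpDl// sqr_ge0.
have [n [z [A B]]] := small_box _ e'0.
apply: le_trans A _; apply: le_trans (ler_wpM2l _ B) _; first exact: exprn_ge0.
rewrite -mulrDl -/s expr_div_n -exprM mulnC exprM.
have -> : 2 ^+ 2 = 4 :> R by ring.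
have -> : 4 ^+ n * (2 * (e / (2 * (s ^+ 2 + 1))) * (s ^+ 2 / 4 ^+ n)) =
   e * (s ^+ 2 / (s ^+ 2 + 1)).
  field; rewrite expf_neq0//= ?andbT; apply: lt0r_neq0.
  by rewrite ltr_wpDl ?sqr_ge0.
rewrite ler_piMr ?(ltW e0)// ler_pdivrMr ?mul1r ?lerDl//.
by rewrite ltr_wpDl ?sqr_ge0.
Qed.

End goursat.

(** * Modulus, differentiability and the exponential in R[i] *)

Section small_o.
Local Open Scope classical_set_scope.

(** This form avoids division and allows [h = 0]. Being over an abstract field it serves both [R]
    and [R[i]]. *)
Lemma is_derive_smalloP {K : numFieldType} {f : K^o -> K^o} {z D : K^o} :
  is_derive z (1 : K^o) f D <->
  forall e : K, 0 < e ->
    \forall h \near (0 : K^o), `|f (z + h) - f z - D * h| <= e * `|h|.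
Proof.
have E : (h^-1 *: ((f \o shift z) (h *: (1 : K^o)) - f z) @[h --> 0^'] --> D) <->
  forall e : K, 0 < e ->
    \forall h \near (0 : K^o), `|f (z + h) - f z - D * h| <= e * `|h|.
  split=> [/cvgrPdist_le H e e0|H].
    have := H _ e0; rewrite !nearE /dnbhs /within /=; apply: filterS => h.
    have [->|h0] := eqVneq h 0; first by rewrite addr0 subrr mulr0 subrr normr0 mulr0.
    move=> /(_ isT); rewrite -(ler_pM2r (x := `|h|)) ?normr_gt0//; apply: le_trans.
    rewrite -normrM -normrN /= [h *: _]mulr1 (addrC z) -[_ *: _]/(_ * _).
    by rewrite mulrBl mulrAC mulVf// mul1r opprB.
  apply/cvgrPdist_le => e e0; have := H _ e0.
  rewrite !nearE /dnbhs /within /=; apply: filterS => h H1 h0.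
  rewrite -(ler_pM2r (x := `|h|)) ?normr_gt0//; apply: le_trans H1.
  rewrite -normrM -normrN /= [h *: _]mulr1 (addrC z) -[_ *: _]/(_ * _).
    by rewrite mulrBl mulrAC mulVf// mul1r opprB.
split=> [[/cvg_ex[l Hl] Df]|H].
  by apply: (proj1 E); rewrite -Df /derive (cvg_lim _ Hl).
move/(proj2 E): H => H.
have df : derivable f z (1 : K^o) by apply/cvg_ex; exists D.
by split => //; apply: cvg_lim H.
Qed.

Lemma continuous_distP {K : numFieldType} {f : K^o -> K^o} {z : K^o} :
  {for z, continuous f} <->
  forall e : K, 0 < e -> \forall h \near z, `|f h - f z| <= e.
Proof.
split=> [/cvgrPdist_le H e e0|H].
  by have := H _ e0; apply: filterS => h; rewrite distrC.
by apply: (proj2 (@cvgrPdist_le K K^o K^o (nbhs z) _ f (f z))) => e e0; have := H _ e0; apply: filterS => h; rewrite distrC.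
Qed.

End small_o.

Section modulus.
Context {R : realType}.
Implicit Types z w : R[i].

Lemma norm_normc z : `|z| = (normc z)%:C.
Proof. by rewrite normc_def; case: z. Qed.

Lemma normc_ge0 z : 0 <= normc z.
Proof. by case: z => a b; apply: sqrtr_ge0. Qed.

Lemma normc_gt0 z : (0 < normc z) = (z != 0).
Proof.
rewrite lt_def normc_ge0 andbT; congr (~~ _); apply/eqP/eqP => [/eq0_normc//|->].
exact: normc0.
Qed.

Lemma inUE z : inU z <-> normc z < 1.
Proof. by rewrite /inU norm_normc -(ltcR (normc z) 1). Qed.

Lemma normcX z n : normc (z ^+ n) = normc z ^+ n.
Proof. by apply: (@complexI R); rewrite rmorphXn/= -!norm_normc normrX. Qed.

Lemma normcR (x : R) : normc x%:C = `|x|.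
Proof. by rewrite /normc/= expr0n/= addr0 sqrtr_sqr. Qed.

Lemma Re_le_normc z : `|complex.Re z| <= normc z.
Proof.
by case: z => x y /=; rewrite -sqrtr_sqr ler_sqrt ?lerDl ?addr_ge0 ?sqr_ge0.
Qed.

Lemma Im_le_normc z : `|complex.Im z| <= normc z.
Proof.
by case: z => x y /=; rewrite -sqrtr_sqr ler_sqrt ?lerDr ?addr_ge0 ?sqr_ge0.
Qed.

Lemma normc_le_ReIm z : normc z <= `|complex.Re z| + `|complex.Im z|.
Proof.
rewrite {1}(complexE z); apply: le_trans (le_normcD _ _) _.
rewrite normcR lerD2l normcM normcR /= expr0n/= expr1n add0r sqrtr1 mul1r.
exact: lexx.
Qed.

Lemma sqr_normcE z : normc z ^+ 2 = complex.Re z ^+ 2 + complex.Im z ^+ 2.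
Proof. by case: z => x y /=; rewrite sqr_sqrtr// addr_ge0 ?sqr_ge0. Qed.

(** Radii and tolerances in [R[i]] are complex numbers whose positivity forces the imaginary part to
    vanish. This lemma and the next two replace them by real ones. *)
Lemma near_complexP (P : R[i] -> Prop) (z : (R[i])^o) :
  (\forall h \near z, P h) <-> exists2 d : R, 0 < d & forall h, normc (h - z) < d -> P h.
Proof.
split=> [/nbhs_ballP[d /= d0 H]|[d d0 H]].
  move: d0; rewrite ltcE /= => /andP[/eqP dI dR].
  exists (complex.Re d) => // h hd; apply: H.
  rewrite -ball_normE /= distrC norm_normc ltcE /= dI eqxx; exact: hd.
apply/nbhs_ballP; exists d%:C; first by rewrite /= ltcR.
by move=> h; rewrite -ball_normE /= distrC norm_normc ltcR => /H.
Qed.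

Lemma continuousC_P (f : (R[i])^o -> (R[i])^o) (z : (R[i])^o) :
  {for z, continuous f} <-> forall e : R, 0 < e -> exists2 d : R, 0 < d &
    forall h, normc (h - z) < d -> normc (f h - f z) <= e.
Proof.
split=> [/continuous_distP H e e0|H].
  have /near_complexP[d d0 Hd] := H _ (eq_ind_r is_true e0 (ltcR 0 e)).
  by exists d => // h /Hd; rewrite norm_normc lecR.
apply/continuous_distP => e; rewrite ltcE => /andP[/eqP eI /H[d d0 Hd]].
by apply/near_complexP; exists d => // h /Hd; rewrite norm_normc lecE /= eI eqxx.
Qed.

Lemma is_deriveC_P (f : (R[i])^o -> (R[i])^o) (z D : (R[i])^o) :
  is_derive z (1 : (R[i])^o) f D <-> forall e : R, 0 < e -> exists2 d : R, 0 < d &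
    forall h, normc h < d -> normc (f (z + h) - f z - D * h) <= e * normc h.
Proof.
split=> [/is_derive_smalloP H e e0|H].
  have /near_complexP[d d0 Hd] := H _ (eq_ind_r is_true e0 (ltcR 0 e)).
  by exists d => // h; rewrite -{1}(subr0 h) => /Hd; rewrite !norm_normc -rmorphM lecR.
apply/is_derive_smalloP => e; rewrite ltcE => /andP[/eqP eI /H[d d0 Hd]].
apply/near_complexP; exists d => // h; rewrite subr0 => /Hd.
have -> : e = (complex.Re e)%:C by move: eI; case: (e) => a b /= ->.
by rewrite !norm_normc -rmorphM lecR.
Qed.

End modulus.

Section cexp.
Context {R : realType}.

Definition cexp (z : (R[i])^o) : (R[i])^o :=
  (expR (complex.Re z) * cos (complex.Im z)) +i* (expR (complex.Re z) * sin (complex.Im z)).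

Lemma cexpD z w : cexp (z + w) = cexp z * cexp w.
Proof.
case: z w => [a b] [c d]; rewrite /cexp /= expRD sinD cosD.
by apply/eqP; rewrite eq_complex /=; apply/andP; split; apply/eqP; ring.
Qed.

Lemma normc_cexp z : normc (cexp z) = expR (complex.Re z).
Proof.
rewrite /cexp /= !exprMn -mulrDr cos2Dsin2 mulr1 sqrtr_sqr ger0_norm // expR_ge0.
Qed.

(** The functional equation moves the question to 0, where it follows from the first order
    expansions of [expR], [cos] and [sin]. *)
Lemma derive_cexp z : is_derive z (1 : (R[i])^o) cexp (cexp z).
Proof.
have small (e : R) : 0 < e -> exists2 d : R, 0 < d & forall x : R, `|x| < d ->
   [/\ `|expR x - 1 - x| <= e * `|x|, `|cos x - 1| <= e * `|x| &
    `|sin x - x| <= e * `|x|] /\ `|expR x - 1| <= e /\ expR x <= 2.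
  move=> e0.
  have dE : is_derive (0 : R^o) (1 : R^o) (expR : R^o -> R^o) 1.
    by have := is_derive_expR (0 : R); rewrite expR0.
  have dC : is_derive (0 : R^o) (1 : R^o) (cos : R^o -> R^o) 0.
    by have := is_derive_cos (0 : R); rewrite sin0 oppr0.
  have dS : is_derive (0 : R^o) (1 : R^o) (sin : R^o -> R^o) 1.
    by have := is_derive_sin (0 : R); rewrite cos0.
  have hE := is_derive_smalloP.1 dE _ e0.
  have hE1 := is_derive_smalloP.1 dE _ ltr01.
  have hC := is_derive_smalloP.1 dC _ e0.
  have hS := is_derive_smalloP.1 dS _ e0.
  have : \forall x \near (0 : R^o), [/\ `|expR x - 1 - x| <= e * `|x|,
       `|cos x - 1| <= e * `|x| & `|sin x - x| <= e * `|x|] /\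
       `|expR x - 1 - x| <= `|x|.
    near=> x; split; first split.
    - by near: x; move: hE; apply: filterS => x; rewrite add0r expR0 mul1r.
    - by near: x; move: hC; apply: filterS => x; rewrite add0r cos0 mul0r subr0.
    - by near: x; move: hS; apply: filterS => x; rewrite add0r sin0 mul1r subr0.
    - by near: x; move: hE1; apply: filterS => x; rewrite add0r expR0 !mul1r.
  move/nbhs_ballP => [d /= d0 H].
  (* From [expR x - 1 - x] being at most the modulus of [x], the bound [e / 2] gives the estimate on
     [expR x - 1], and [1 / 2] gives [expR x <= 2]. *)
  exists (Num.min d (Num.min (e / 2) (1 / 2))).
    by rewrite !lt_min d0 !divr_gt0.
  move=> x; rewrite !lt_min => /and3P[xd xe x1].
  have [| A B] := H x; first by rewrite -ball_normE /= sub0r normrN.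
  split => //; split.
    have -> : expR x - 1 = (expR x - 1 - x) + x by ring.
    by apply: le_trans (ler_normD _ _) _; lra.
  have : expR x - 1 - x <= `|x| by apply: le_trans B; apply: ler_norm.
  have := ler_norm x; lra.
apply/is_deriveC_P => e e0.
(* The real and the imaginary part each cost three units of error: one from a first order remainder
   or a product, two from a factor bounded by 2. *)
have eN0 : 0 < e / (6 * expR (complex.Re z)).
  by rewrite divr_gt0// mulr_gt0// expR_gt0.
have [d d0 H] := small _ eN0; exists d => // h hd.
have -> : cexp (z + h) - cexp z - cexp z * h = cexp z * (cexp h - 1 - h).
  by rewrite cexpD; ring.
rewrite normcM normc_cexp.
set k := e / _ in eN0 H.
have -> : e * normc h = expR (complex.Re z) * (6 * k * normc h).
  by rewrite /k; field; rewrite lt0r_neq0// expR_gt0.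
rewrite ler_wpM2l ?expR_ge0//.
have [[E1 _ _] [E2 E3]] := H _ (le_lt_trans (Re_le_normc h) hd).
have [[_ C1' S1'] _] := H _ (le_lt_trans (Im_le_normc h) hd).
have hR := Re_le_normc h; have hI := Im_le_normc h.
apply: le_trans (normc_le_ReIm _) _.
move: E1 E2 E3 C1' S1' hR hI; case: h hd => x y /= hd.
set m := Num.sqrt _ => E1 E2 E3 C1 S1 hR hI.
have m0 : 0 <= m by apply: sqrtr_ge0.
have km : k * `|x| <= k * m by rewrite ler_wpM2l// ltW.
have km' : k * `|y| <= k * m by rewrite ler_wpM2l// ltW.
have -> : expR x * cos y - 1 - x = (expR x - 1 - x) + expR x * (cos y - 1) by ring.
have -> : expR x * sin y - 0 - y = (expR x - 1) * y + expR x * (sin y - y) by ring.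
have T1 : `|expR x * (cos y - 1)| <= 2 * (k * m).
  rewrite normrM ger0_norm ?expR_ge0// ler_pM ?expR_ge0//.
  exact: le_trans km'.
have T2 : `|expR x * (sin y - y)| <= 2 * (k * m).
  rewrite normrM ger0_norm ?expR_ge0// ler_pM ?expR_ge0//.
  exact: le_trans km'.
have T3 : `|(expR x - 1) * y| <= k * m by rewrite normrM ler_pM.
apply: le_trans (lerD (ler_normD _ _) (ler_normD _ _)) _; lra.
Unshelve. all: by end_near. Qed.

End cexp.

(** * Functions holomorphic in the punctured disc *)

Section punctured_disc.
Context {R : realType}.
Implicit Types f : (R[i])^o -> (R[i])^o.

Lemma derivableC_continuous f (z : (R[i])^o) : derivable f z 1 -> {for z, continuous f}.
Proof. by move=> df; apply/differentiable_continuous/derivable1_diffP. Qed.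

(** With [pr] the real or imaginary part and [w] equal to i or 1, this makes the restrictions to
    vertical and horizontal lines continuous, hence integrable. *)
Lemma continuous_on_line f (z w : R[i]) (T : R) (pr : R[i] -> R) :
  (forall u v, `|pr u - pr v| <= normc (u - v)) -> normc w = 1 ->
  {for (z + T%:C * w : (R[i])^o), continuous f} ->
  {for T, continuous (fun t : R => pr (f (z + t%:C * w)) : R)}.
Proof.
move=> prL w1 /continuousC_P cf.
apply: (proj2 (@continuous_distP R _ T)) => e e0.
have [d d0 H] := cf _ e0; apply/nbhs_ballP; exists d => //= t.
rewrite -ball_normE /= => td; apply: le_trans (prL _ _) (H _ _).
have -> : z + t%:C * w - (z + T%:C * w) = (t - T)%:C * w.
  by rewrite rmorphB; ring.
by rewrite normcM w1 mulr1 normcR distrC.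
Qed.

Lemma Re_lip (u v : R[i]) : `|complex.Re u - complex.Re v| <= normc (u - v).
Proof. by case: u v => [a b] [c d]; apply: (Re_le_normc (_ +i* _)). Qed.

Lemma Im_lip (u v : R[i]) : `|complex.Im u - complex.Im v| <= normc (u - v).
Proof. by case: u v => [a b] [c d]; apply: (Im_le_normc (_ +i* _)). Qed.

(** By [goursat] on the pullback by [cexp], the mean of the real part is the same on the circle of
    radius [r] and on a very small one. The first is nonpositive; were the value at 0 positive, the
    second would be positive by continuity. *)
Lemma Re_center_le0 f (r : R) : 0 < r < 1 ->
  (forall z, z != 0 -> inU z -> derivable f z 1) ->
  {for (0 : (R[i])^o), continuous f} ->
  (forall z, normc z = r -> complex.Re (f z) <= 0) -> complex.Re (f 0) <= 0.
Proof.
move=> /andP[r0 r1] df cf fr; rewrite leNgt; apply/negP => c0.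
have [d d0 Hd] := (continuousC_P f 0).1 cf _ (divr_gt0 c0 (ltr0n _ 2)).
pose L := ln r; have L0 : L < 0 by apply: ln_lt0; rewrite r0.
have eL : expR L = r by apply: lnK; rewrite posrE.
(* This puts [x1] left of [L] and makes [expR x1] smaller than [d], so on the small circle the real
   part stays above half its value at 0. *)
pose x1 := Num.min L (ln d) - 1.
have x1L : x1 < L by rewrite /x1; case: (leP L (ln d)) => ?; lra.
have x1d : expR x1 < d.
  by rewrite -[ltRHS](lnK (x := d)) ?posrE// ltr_expR /x1; case: (leP L (ln d)) => ?; lra.
pose pt (x y : R) : (R[i])^o := x +i* y.
pose G : (R[i])^o -> (R[i])^o := f \o cexp.
have dG (x y : R) : x < 0 -> derivable G (pt x y) 1.
  move=> x0; apply/derivable1_diffP/differentiable_comp; apply/derivable1_diffP.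
    by have [] := derive_cexp (pt x y).
  apply: df; first by rewrite -normc_gt0 normc_cexp expR_gt0.
  by apply/inUE; rewrite normc_cexp /= -expR0 ltr_expR.
have cG (x y : R) : x < 0 -> {for pt x y, continuous G}.
  by move=> /(dG _ y)/derivableC_continuous.
pose p (x y : R) := complex.Re (G (pt x y)).
pose q (x y : R) := complex.Im (G (pt x y)).
have cp (x y : R) : x < 0 -> continuous_at y (p x).
  move=> x0; have ptE t : pt x t = x%:C + t%:C * 'i%C.
    by apply/eqP; rewrite eq_complex /= ; apply/andP; split; apply/eqP; ring.
  have -> : p x = fun t => complex.Re (G (x%:C + t%:C * 'i%C)).
    by apply/funext => t; rewrite -ptE.
  apply: continuous_on_line; [exact: Re_lip| |by rewrite -ptE; apply: cG].
  by rewrite /normc expr0n expr1n add0r sqrtr1.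
have cq (x y : R) : x < 0 -> continuous_at x (q ^~ y).
  move=> x0; have ptE t : pt t y = y *i + t%:C * 1.
    by apply/eqP; rewrite eq_complex /= ; apply/andP; split; apply/eqP; ring.
  have -> : q ^~ y = fun t => complex.Im (G (y *i + t%:C * 1)).
    by apply/funext => t; rewrite -ptE.
  by apply: continuous_on_line; [exact: Im_lip|exact: normc1|rewrite -ptE; apply: cG].
have pi0 : 0 < pi :> R := pi_gt0 R.
(* The margins around 0 and [pi *+ 2], and below around [x1] and [L], provide two-sided derivatives
   on the closed rectangle. Since [L < 0], the bound [L / 2] lies right of [L] and still in the left
   half-plane. *)
have /choice[P dP] (x : R) : exists H : R -> R, x < 0 ->
    forall y : R, -1 < y < pi *+ 2 + 1 -> is_derive y 1 H (p x y).
  have [x0|] := ltP x 0; last by exists id.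
  have [||H dH] := @antiderivative_exists R (p x) (-1) (pi *+ 2 + 1).
  - by rewrite mulr2n; lra.
  - by move=> y _; apply: cp.
  - by exists H.
have /choice[Q dQ] (y : R) : exists H : R -> R,
    forall x : R, x1 - 1 < x < L / 2 -> is_derive x 1 H (q x y).
  apply: antiderivative_exists; first by lra.
  by move=> x x12; apply: cq; lra.
have : boundary_int P (fun x y => Q y x) x1 L 0 (pi *+ 2) = 0.
  apply: (@goursat R p q) => [||x y xy|x y xy|x0 y0 xy].
  - by lra.
  - by rewrite mulr2n; lra.
  - by apply: dP; lra.
  - by apply: dQ; lra.
  - have x00 : x0 < 0 by lra.
    have /derivableP/is_deriveC_P dGx := dG _ y0 x00.
    exists (complex.Re ('D_1 G (pt x0 y0))), (complex.Im ('D_1 G (pt x0 y0))) => e e0.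
    (* Two coordinates of size at most [d' / 3] give a modulus below [d']. *)
    have [d' d'0 H] := dGx _ e0; exists (d' / 3); first by lra.
    move=> x y _ hx hy; pose h := pt (x - x0) (y - y0).
    have hN : normc h <= `|x - x0| + `|y - y0| := normc_le_ReIm h.
    have {}H := H h ltac:(lra).
    have ph : pt x0 y0 + h = pt x y.
      by apply/eqP; rewrite eq_complex /=; apply/andP; split; apply/eqP; ring.
    rewrite ph in H.
    have eN : e * normc h <= e * (`|x - x0| + `|y - y0|) by rewrite ler_wpM2l// ltW.
    split; apply: le_trans eN; apply: le_trans H.
      apply: le_trans (Re_le_normc _); rewrite /p /h.
      case: (G (pt x y)) (G (pt x0 y0)) ('D_1 G (pt x0 y0)) => [a b] [a' b'] [s t] /=.
      exact: lexx.
    apply: le_trans (Im_le_normc _); rewrite /q /h.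
    case: (G (pt x y)) (G (pt x0 y0)) ('D_1 G (pt x0 y0)) => [a b] [a' b'] [s t] /=.
    rewrite (addrC (s * _)); exact: lexx.
rewrite /boundary_int.
have [||y1 hy1 E1] := @mean_value_closed R (P L) (p L) 0 (pi *+ 2).
- by rewrite mulr2n; lra.
- by move=> y hy; apply: dP; lra.
have [||y2 hy2 E2] := @mean_value_closed R (P x1) (p x1) 0 (pi *+ 2).
- by rewrite mulr2n; lra.
- by move=> y hy; apply: dP; lra.
have [||x2 hx2 E3] := @mean_value_closed R (fun x => Q 0 x - Q (pi *+ 2) x)
   (fun x => q x 0 - q x (pi *+ 2)) x1 L.
- by lra.
- by move=> x hx; apply: is_deriveB; apply: dQ; lra.
(* The horizontal sides cancel because [cexp] has period 2 pi i. *)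
have qE : q x2 0 - q x2 (pi *+ 2) = 0.
  by rewrite /q /G /= /cexp /= cos2pi sin2pi cos0 sin0 subrr.
rewrite qE mul0r in E3.
have pL : p L y1 <= 0 by apply: fr; rewrite normc_cexp.
have px1 : 0 < p x1 y2.
  have /Hd Hn : normc (cexp (pt x1 y2) - 0) < d by rewrite subr0 normc_cexp.
  have := le_trans (Re_lip _ _) Hn; rewrite -/(G _) -/(p _ _) ler_norml; lra.
have A1 : p L y1 * (pi *+ 2 - 0) <= 0 by rewrite mulr_le0_ge0// subr0 mulr2n; lra.
have A2 : 0 < p x1 y2 * (pi *+ 2 - 0) by rewrite mulr_gt0// subr0 mulr2n; lra.
rewrite E1 E2 => E; move: E3 A1 A2 E; lra.
Qed.

End punctured_disc.

(** * Second order expansions *)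

Section pointwise_rules.
Context {K : numFieldType}.
Implicit Types (f g : K^o -> K^o) (z c : K^o).

Lemma derivable_fD f g z : derivable f z 1 -> derivable g z 1 ->
  derivable (fun x => f x + g x) z 1.
Proof. exact: derivableD. Qed.

Lemma derivable_fM f g z : derivable f z 1 -> derivable g z 1 ->
  derivable (fun x => f x * g x) z 1.
Proof. exact: derivableM. Qed.

Lemma derivable_fV f z : f z != 0 -> derivable f z 1 ->
  derivable (fun x => (f x)^-1) z 1.
Proof. exact: derivableV. Qed.

Lemma derivable_fcst c z : derivable (fun=> c) z 1.
Proof. exact: derivable_cst. Qed.

Lemma derivable_fid z : derivable (fun x : K^o => x) z 1.
Proof. exact: derivable_id. Qed.

Lemma continuous_fD f g z : continuous_at z f -> continuous_at z g ->
  continuous_at z (fun x => f x + g x).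
Proof. exact: (@cvgD K K^o K^o (nbhs z) _ f g). Qed.

Lemma continuous_fM f g z : continuous_at z f -> continuous_at z g ->
  continuous_at z (fun x => f x * g x).
Proof. exact: (@cvgM K K^o (nbhs z) _ f g). Qed.

Lemma continuous_fV f z : f z != 0 -> continuous_at z f ->
  continuous_at z (fun x => (f x)^-1).
Proof. by move=> fz cf; apply: (@cvgV K K^o (nbhs z) _ f). Qed.

Lemma continuous_fcst c z : continuous_at z (fun=> c).
Proof. by rewrite /continuous_at; apply: (@cvg_cst K^o c K^o (nbhs z)). Qed.

Lemma continuous_fid z : continuous_at z (fun x : K^o => x).
Proof. by move=> A. Qed.

End pointwise_rules.

(* The rules are selected syntactically and used over an abstract [K]: unification up
   to conversion on [R[i]] is prohibitively slow. *)
Ltac fun_closure lcst lid lD lM lV :=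
  lazymatch goal with
  | |- continuous_at _ (fun _ => ?c) => exact: (lcst _ c)
  | |- derivable (fun _ => ?c) _ _ => exact: (lcst _ c)
  | |- continuous_at _ (fun x => x) => exact: (lid _)
  | |- derivable (fun x => x) _ _ => exact: (lid _)
  | |- context [fun x => @Algebra.add _ (@?a x) (@?b x)] =>
      apply: (lD _ a b); fun_closure lcst lid lD lM lV
  | |- context [fun x => @GRing.mul _ (@?a x) (@?b x)] =>
      apply: (lM _ a b); fun_closure lcst lid lD lM lV
  | |- context [fun x => @GRing.exp _ (@?a x) 2] =>
      apply: (lM _ a a); fun_closure lcst lid lD lM lV
  | |- context [fun x => @GRing.inv _ (@?a x)] =>
      apply: (lV _ a); [|fun_closure lcst lid lD lM lV]
  | |- context [fun x => ?f x] => change (fun x => f x) with f; try assumption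
  | |- _ => try assumption
  end.

Ltac continuity :=
  fun_closure @continuous_fcst @continuous_fid @continuous_fD @continuous_fM @continuous_fV.
Ltac derivability :=
  fun_closure @derivable_fcst @derivable_fid @derivable_fD @derivable_fM @derivable_fV.

Section generic_calculus.
Context {K : numFieldType}.
Implicit Types (f g : K^o -> K^o) (z : K^o).

Lemma continuous_near_eq f g z : (\forall x \near z, f x = g x) ->
  continuous_at z f -> continuous_at z g.
Proof.
move=> fg cf; rewrite /continuous_at -(nbhs_singleton fg).
by apply: cvg_trans cf; exact: (@near_eq_cvg K^o K^o (nbhs z) _ f g fg).
Qed.

Lemma derivable_slope (w : K^o -> K^o) (b z : K^o) : z != 0 -> derivable w z 1 ->
  derivable (fun x => (w x * x^-1 + - b) * x^-1 : K^o) z 1.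
Proof. by move=> z0 dw; derivability. Qed.

(* The shape of the function to which [Re_center_le0] is applied, with
   [k z = (w z / z - b1) / z]. *)
Definition quad_affine (p0 p1 q0 q1 q2 : K) (k : K^o -> K^o) : K^o -> K^o :=
  fun z => p0 + p1 * z + (q0 + q1 * z + q2 * z ^+ 2) * k z.

Lemma continuous_quad_affine p0 p1 q0 q1 q2 k z : continuous_at z k ->
  continuous_at z (quad_affine p0 p1 q0 q1 q2 k).
Proof. by move=> ck; rewrite /quad_affine; continuity. Qed.

Lemma derivable_quad_affine p0 p1 q0 q1 q2 k z : derivable k z 1 ->
  derivable (quad_affine p0 p1 q0 q1 q2 k) z 1.
Proof. by move=> dk; rewrite /quad_affine; derivability. Qed.

End generic_calculus.

(** * Algebra of second order expansions at 0 *)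

Section taylor2.
Context {K : numFieldType}.
Implicit Types F G : K^o -> K^o.

(* [psi] continuous with [psi 0 = c2] says that the remainder is o(z^2). *)
Definition taylor2 F (c0 c1 c2 : K^o) : Prop := exists psi : K^o -> K^o,
  [/\ continuous_at (0 : K^o) psi, psi 0 = c2 &
      \forall z \near (0 : K^o), F z = c0 + c1 * z + z ^+ 2 * psi z].

Lemma near0_imp2 {P Q S : K^o -> Prop} : (forall z, P z -> Q z -> S z) ->
  (\forall z \near (0 : K^o), P z) -> (\forall z \near (0 : K^o), Q z) ->
  \forall z \near (0 : K^o), S z.
Proof. by move=> PQS p q; near=> z; apply: PQS; near: z. Unshelve. all: by end_near. Qed.

Lemma near0_all {P : K^o -> Prop} : (forall z, P z) -> \forall z \near (0 : K^o), P z.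
Proof. by move=> p; near=> z. Unshelve. all: by end_near. Qed.

Lemma near0_comp {P : K^o -> Prop} {G} : continuous_at (0 : K^o) G -> G 0 = 0 ->
  (\forall z \near (0 : K^o), P z) -> \forall z \near (0 : K^o), P (G z).
Proof. by move=> cG G0; rewrite -{1}G0 => /cG. Qed.

Lemma taylor2_0 F {c0 c1 c2} : taylor2 F c0 c1 c2 -> F 0 = c0.
Proof.
by case=> psi [_ _ /nbhs_singleton ->]; rewrite mulr0 expr0n mul0r !addr0.
Qed.

Lemma taylor2_near_eq {F G c0 c1 c2} : (\forall z \near (0 : K^o), F z = G z) ->
  taylor2 F c0 c1 c2 -> taylor2 G c0 c1 c2.
Proof.
move=> FG [psi [cp p0 Ep]]; exists psi; split => //.
by apply: near0_imp2 FG Ep => z <-.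
Qed.

Lemma taylor2_eq {F c0 c1 c2 d0 d1 d2} : taylor2 F c0 c1 c2 ->
  c0 = d0 -> c1 = d1 -> c2 = d2 -> taylor2 F d0 d1 d2.
Proof. by move=> + <- <- <-. Qed.

Lemma taylor2_cst c : taylor2 (fun=> c) c 0 0.
Proof.
exists (fun=> 0); split=> //; first exact: continuous_fcst.
by apply: near0_all => z; rewrite mul0r mulr0 !addr0.
Qed.

Lemma taylor2_id : taylor2 (fun z => z) 0 1 0.
Proof.
exists (fun=> 0); split=> //; first exact: continuous_fcst.
by apply: near0_all => z; rewrite mul1r mulr0 add0r addr0.
Qed.

Lemma taylor2D {F G c0 c1 c2 d0 d1 d2} : taylor2 F c0 c1 c2 -> taylor2 G d0 d1 d2 ->
  taylor2 (fun z => F z + G z) (c0 + d0) (c1 + d1) (c2 + d2).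
Proof.
move=> [p [cp p0 Ep]] [q [cq q0 Eq]]; exists (fun z => p z + q z); split.
- by continuity.
- by rewrite p0 q0.
by apply: near0_imp2 Ep Eq => z -> ->; ring.
Qed.

Lemma taylor2M {F G c0 c1 c2 d0 d1 d2} : taylor2 F c0 c1 c2 -> taylor2 G d0 d1 d2 ->
  taylor2 (fun z => F z * G z) (c0 * d0) (c0 * d1 + c1 * d0)
    (c0 * d2 + c1 * d1 + c2 * d0).
Proof.
move=> [p [cp p0 Ep]] [q [cq q0 Eq]].
exists (fun z => c0 * q z + c1 * d1 + d0 * p z + z * (c1 * q z + d1 * p z)
   + z * z * (p z * q z)); split.
- by continuity.
- by rewrite p0 q0; ring.
by apply: near0_imp2 Ep Eq => z -> ->; ring.
Qed.

Lemma taylor2_continuous {F c0 c1 c2} : taylor2 F c0 c1 c2 -> continuous_at (0 : K^o) F.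
Proof.
move=> [p [cp p0 Ep]].
apply: (continuous_near_eq (fun z => c0 + c1 * z + z * z * p z)).
  by apply: filterS Ep => z ->; rewrite expr2.
by continuity.
Qed.

Lemma near_neq0 {F} : continuous_at (0 : K^o) F -> F 0 != 0 ->
  \forall z \near (0 : K^o), F z != 0.
Proof.
move=> cF F0; have := (@continuous_distP K F 0).1 cF (`|F 0| / 2).
rewrite divr_gt0 ?normr_gt0// => /(_ isT); apply: filterS => z.
apply: contraTneq => ->; rewrite sub0r normrN -subr_ge0.
have -> : `|F 0| / 2 - `|F 0| = - (`|F 0| / 2) :> K by field.
by rewrite oppr_ge0 lt_geF// divr_gt0 ?normr_gt0.
Qed.

Lemma taylor2V {F c0 c1 c2} : c0 != 0 -> taylor2 F c0 c1 c2 ->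
  taylor2 (fun z => (F z)^-1) c0^-1 (- c1 / c0 ^+ 2) ((c1 ^+ 2 - c0 * c2) / c0 ^+ 3).
Proof.
move=> c00 TF; have cF := taylor2_continuous TF; have F0 := taylor2_0 _ TF.
have Fn : \forall z \near (0 : K^o), F z != 0 by apply: near_neq0; rewrite ?F0.
case: TF => [p [cp p0 Ep]].
(* This is [1 / F - 1 / c0 + c1 * z / c0 ^+ 2] over a common denominator, divided by [z ^+ 2]. *)
exists (fun z => (c1 * (c1 + z * p z) + - c0 * p z) * (c0 ^+ 2)^-1 * (F z)^-1); split.
- by continuity; rewrite F0.
- by rewrite p0 F0; field.
apply: near0_imp2 Fn Ep => z Fz Ez.
have {}Ez : p z * z ^+ 2 = F z - c0 - c1 * z by rewrite Ez; ring.
have -> : z ^+ 2 * ((c1 * (c1 + z * p z) + - c0 * p z) / c0 ^+ 2 / F z) =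
  (c1 * (c1 * z ^+ 2 + z * (p z * z ^+ 2)) - c0 * (p z * z ^+ 2)) / c0 ^+ 2 / F z.
  by field; rewrite c00 Fz.
by rewrite Ez; field; rewrite c00 Fz.
Qed.

Lemma taylor2_comp {F G c0 c1 c2 d1 d2} : taylor2 F c0 c1 c2 -> taylor2 G 0 d1 d2 ->
  taylor2 (fun z => F (G z)) c0 (c1 * d1) (c1 * d2 + c2 * d1 ^+ 2).
Proof.
move=> [p [cp p0 Ep]] TG; have cG := taylor2_continuous TG; have G0 := taylor2_0 _ TG.
case: TG => [q [cq q0 Eq]].
have cpG : continuous_at (0 : K^o) (fun z => p (G z)).
  by apply: (@continuous_comp K^o K^o K^o G p 0 cG); rewrite G0.
exists (fun z => c1 * q z + (d1 + z * q z) ^+ 2 * p (G z)); split.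
- by continuity.
- by rewrite G0 q0 p0; ring.
have {}Ep : \forall z \near (0 : K^o), F (G z) = c0 + c1 * G z + G z ^+ 2 * p (G z).
  exact: near0_comp Ep.
by apply: near0_imp2 Ep Eq => z -> ->; ring.
Qed.

(** An implicit function expansion that starts from mere continuity of [u]: factoring gives
    [u * m = z * (c1 + z * y)] with [m] tending to [p1], and feeding this back once yields the
    second coefficient. It serves both for the Schwarz function of a subordination and for the
    inverse of [f]. *)
Lemma taylor2_root {P F u : K^o -> K^o} {p0 p1 p2 c1 c2} : p1 != 0 ->
  taylor2 P p0 p1 p2 -> taylor2 F p0 c1 c2 -> continuous_at (0 : K^o) u -> u 0 = 0 ->
  (\forall z \near (0 : K^o), P (u z) = F z) ->
  taylor2 u 0 (c1 / p1) ((c2 - p2 * (c1 / p1) ^+ 2) / p1).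
Proof.
move=> p10 [x [cx x0 Ex]] [y [cy y0 Ey]] cu u0 PF.
have cxu : continuous_at (0 : K^o) (fun z => x (u z)).
  by apply: (@continuous_comp K^o K^o K^o u x 0 cu); rewrite u0.
pose m (z : K^o) : K^o := p1 + u z * x (u z).
have cm : continuous_at (0 : K^o) m by rewrite /m; continuity.
have m0 : m 0 = p1 by rewrite /m u0 mul0r addr0.
have mn : \forall z \near (0 : K^o), m z != 0 by apply: near_neq0; rewrite ?m0.
exists (fun z => (p1 * y z + - c1 * ((c1 + z * y z) * (m z)^-1 * x (u z)))
    * (p1 * m z)^-1); split.
- by continuity; rewrite m0 ?mulf_neq0.
- by rewrite m0 u0 x0 y0; field.
have {}Ex : \forall z \near (0 : K^o), P (u z) = p0 + p1 * u z + u z ^+ 2 * x (u z).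
  exact: near0_comp Ex.
apply: near0_imp2 (filterI Ex PF) (filterI Ey mn) => z [E1 E2] [E3 mz].
have um : u z * m z = z * (c1 + z * y z).
  apply: (addrI p0); rewrite /m; transitivity (P (u z)); first by rewrite E1; ring.
  by rewrite E2 E3; ring.
have -> : z ^+ 2 * ((p1 * y z + - c1 * ((c1 + z * y z) / m z * x (u z))) / (p1 * m z)) =
  (z ^+ 2 * p1 * y z - c1 * z * (z * (c1 + z * y z)) / m z * x (u z)) / (p1 * m z).
  by field; rewrite mz p10.
have -> : z ^+ 2 * p1 * y z = p1 * (z * (c1 + z * y z) - c1 * z) by ring.
by rewrite -um /m; move: mz; rewrite /m => mz; field; rewrite mz p10.
Qed.

(* With [f1 = f'] and [f2 = f''] this is the expansion of [Gop l f]. *)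
Lemma taylor2_Gop {f1 f2 : K^o -> K^o} {l a2 a3 x : K} :
  taylor2 f1 1 (2 * a2) (3 * a3) -> taylor2 f2 (2 * a2) (6 * a3) x ->
  taylor2 (fun z => (1 - l) * f1 z + l * (1 + z * f2 z / f1 z))
    1 (2 * a2) (3 * (1 + l) * a3 - 4 * l * a2 ^+ 2).
Proof.
move=> T1 T2.
apply: taylor2_eq.
  apply: (taylor2D (taylor2M (taylor2_cst (1 - l)) T1)
    (taylor2M (taylor2_cst l) (taylor2D (taylor2_cst 1)
      (taylor2M (taylor2M taylor2_id T2) (taylor2V (oner_neq0 _) T1))))).
all: by field.
Qed.

(* For an inverse [g] of [f] one has [g' = 1 / f'(g)] and
   [g'' = - f''(g) / f'(g) ^ 3]. *)
Lemma taylor2_Gop_inverse {f1 f2 g : K^o -> K^o} {l a2 a3 x : K} :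
  taylor2 f1 1 (2 * a2) (3 * a3) -> taylor2 f2 (2 * a2) (6 * a3) x ->
  taylor2 g 0 1 (- a2) ->
  taylor2 (fun w => (1 - l) * (f1 (g w))^-1
      + l * (1 - w * f2 (g w) / f1 (g w) ^+ 2))
    1 (- (2 * a2)) (3 * (1 + l) * (2 * a2 ^+ 2 - a3) - 4 * l * a2 ^+ 2).
Proof.
move=> T1 T2 Tg.
have V1 := taylor2V (oner_neq0 _) (taylor2_comp T1 Tg).
apply: (@taylor2_near_eq (fun w => (1 - l) * (f1 (g w))^-1
      + l * (1 + -1 * (w * f2 (g w) * ((f1 (g w))^-1 * (f1 (g w))^-1))))).
  by apply: near0_all => w; rewrite expr2 invfM mulN1r.
apply: taylor2_eq.
  apply: (taylor2D (taylor2M (taylor2_cst (1 - l)) V1)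
    (taylor2M (taylor2_cst l) (taylor2D (taylor2_cst 1)
      (taylor2M (taylor2_cst (-1))
      (taylor2M (taylor2M taylor2_id (taylor2_comp T2 Tg)) (taylor2M V1 V1)))))).
all: by field.
Qed.

End taylor2.

(** * Schwarz functions *)

Section taylor2.
Context {R : realType}.
Local Notation C := (R[i])^o.
Implicit Types F G : C -> C.

Lemma conj_mul_normc (z : R[i]) : z * z^*%C = (normc z ^+ 2)%:C.
Proof. by rewrite -sqr_normc norm_normc rmorphXn. Qed.

(** On the circle the conjugate of [z] is [s / z] with [s = r ^+ 2], so the real expression of the
    overview is the real part of a function of [z] and [K z], namely [F]. The conclusion is
    [Re_center_le0] read off at [F 0], where [K] equals [b2]. *)
Lemma schwarz_taylor2_circle (w : C -> C) (b1 b2 e : C) (r : R) : analytic_U w ->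
  (forall z, inU z -> inU (w z)) -> taylor2 w 0 b1 b2 -> 0 < r < 1 ->
  normc e = 1 ->
  2 * r ^+ 4 * (normc b1 ^+ 2 + complex.Re (e^*%C * b2)) <= 1 + r ^+ 4.
Proof.
move=> aw wU T2 /andP[r0 r1] e1; have w0 := taylor2_0 _ T2.
case: T2 => psi [cpsi psi0 Epsi].
(* The second divided difference of [w] at 0, with its limit [b2] filled in at 0. *)
pose K (z : C) : C := if z == 0 then b2 else (w z / z - b1) / z.
have cK : continuous_at (0 : C) K.
  apply: continuous_near_eq cpsi; apply: filterS Epsi => z Ez; rewrite /K.
  by have [->|z0] := eqVneq z 0; [exact: psi0|rewrite Ez; field].
have wK z : w z = z * (b1 + z * K z).
  by rewrite /K; have [->|z0] := eqVneq z 0; [rewrite w0 mul0r|field].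
have dK z : z != 0 -> inU z -> derivable K z 1.
  move=> z0 zU.
  apply: (@near_eq_derivable _ C C (fun x => (w x / x - b1) / x) K).
    apply/near_complexP; exists (normc z); first by rewrite normc_gt0.
    move=> x xz; have x0 : x != 0.
      by move: xz; apply: contraTneq => ->; rewrite sub0r normcN ltxx.
    by rewrite /K (negbTE x0).
  exact: (@derivable_slope _ w b1 z z0 (aw _ zU)).
pose s : C := (r ^+ 2)%:C.
pose beta := b1^*%C * e.
pose u := b1^*%C + beta * e^*%C * s.
(* The one term with a pole, a multiple of [s / z], is replaced by its complex conjugate on the
   circle; this gives the summand [e * b1^*%C] in the coefficient of [z]. *)
pose F : C -> C := quad_affine
   (2 * s * b1 * u - (1 + beta * beta^*%C * s + s * (b1 * b1^*%C + e * e^*%C * s)))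
   (2 * s * (b1 * beta * b1^*%C + e * b1^*%C) - 2 * (beta + s * b1^*%C * e))
   (2 * s * (e^*%C * s)) (2 * s * u) (2 * s * (beta * b1^*%C)) K.
have cF : continuous_at (0 : C) F := continuous_quad_affine _ _ _ _ _ _ _ cK.
have dF z : z != 0 -> inU z -> derivable F z 1.
  by move=> z0 zU; apply: derivable_quad_affine; apply: dK.
have FU z : normc z = r -> complex.Re (F z) <= 0.
  move=> zr.
  have zU : inU z by apply/inUE; rewrite zr.
  have ww : normc (w z) ^+ 2 <= 1.
    by rewrite expr_le1 ?normc_ge0// ltW//; apply/inUE/wU.
  have sz : r ^+ 2 = normc z ^+ 2 by rewrite zr.
  move: ww; rewrite wK /F /quad_affine /u /beta /s sz !sqr_normcE.
  move: (K z) => k; clear.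
  case: b1 k e z => [a b] [k1 k2] [e1 e2] [x y] ww.
  set X := (x +i* y) * _ in ww; set beta := (a +i* b)^*%C * (e1 +i* e2).
  pose W := 1 + beta * (x +i* y); pose Y := (a +i* b) + (e1 +i* e2) * (x +i* y).
  pose V := (x +i* y) * Y.
  (* Minus the real part of [F z] is the sum of two nonnegative quantities: the squared modulus of
     [W] minus that of [X * W], and the squared modulus of [X * W - V]. *)
  have mono : (complex.Re X ^+ 2 + complex.Im X ^+ 2) * (complex.Re W ^+ 2 + complex.Im W ^+ 2)
     <= complex.Re W ^+ 2 + complex.Im W ^+ 2.
    by rewrite ler_piMl// addr_ge0 ?sqr_ge0.
  have sq : 0 <= (complex.Re (X * W) - complex.Re V) ^+ 2 + (complex.Im (X * W) - complex.Im V) ^+ 2.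
    by rewrite addr_ge0 ?sqr_ge0.
  rewrite -subr_ge0 in mono; rewrite -subr_le0 -oppr_ge0.
  apply: le_trans (addr_ge0 mono sq) _; rewrite le_eqVlt; apply/orP; left; apply/eqP.
  rewrite /X /W /V /Y /beta /= => {mono sq ww}.
  ring.
have := Re_center_le0 F r _ dF cF FU; rewrite r0 r1 => /(_ isT).
rewrite /F /quad_affine expr0n !mulr0 !addr0 /K eqxx /u /beta /s.
have := sqr_normcE e; rewrite e1 expr1n sqr_normcE => e2.
have -> : r ^+ 4 = (r ^+ 2) ^+ 2 by rewrite -exprM.
move: (r ^+ 2) e2 => t; clear; case: b1 b2 e => [a b] [c d] [u v] /= uv.
set X := (X in X <= 0 -> _) => X0.
have XE : X = 2 * t ^+ 2 * (a ^+ 2 + b ^+ 2 + (u * c + v * d)) - 1 - t ^+ 2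
   + (u ^+ 2 + v ^+ 2 - 1) * (2 * t ^+ 2 * (a ^+ 2 + b ^+ 2)
   - t * (a ^+ 2 + b ^+ 2) - t ^+ 2) by rewrite /X; ring.
by move: X0; rewrite XE -uv subrr mul0r mulNr opprK; lra.
Qed.

(** Choosing [e] as the direction of [b2] turns the real part into [normc b2]; then [r] tends to 1
    in the circle inequality. *)
Lemma schwarz_taylor2 (w : C -> C) (b1 b2 : C) : analytic_U w ->
  (forall z, inU z -> inU (w z)) -> taylor2 w 0 b1 b2 ->
  normc b1 ^+ 2 + normc b2 <= 1.
Proof.
move=> aw wU T2.
have [e e1 <-] : exists2 e : C, normc e = 1 & complex.Re (e^*%C * b2) = normc b2.
  have [->|b20] := eqVneq b2 0; first by exists 1; rewrite ?normc1// mulr0 normc0.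
  have n0 : normc b2 != 0 by rewrite lt0r_neq0// normc_gt0.
  exists (b2 * ((normc b2)^-1)%:C : R[i]).
    by rewrite normcM normcR ger0_norm ?invr_ge0 ?normc_ge0// divff.
  have -> : (b2 * ((normc b2)^-1)%:C : R[i])^*%C * b2 =
      (b2 * b2^*%C : R[i]) * ((normc b2)^-1)%:C.
    case: (b2) (normc b2)^-1 => [c d] n.
    by apply/eqP; rewrite eq_complex /=; apply/andP; split; apply/eqP; ring.
  by rewrite conj_mul_normc -rmorphM /= expr2 mulfK.
set m := _ + _; rewrite leNgt; apply/negP => m1.
(* If [m > 1], the radius [1 - h] already contradicts the circle inequality: it forces
   [q * (2 * m - 1) <= 1], while Bernoulli's bound makes the left side at least [m]. *)
pose h := (m - 1) / (4 * (2 * m - 1)).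
have h0 : 0 < h by rewrite divr_gt0 ?mulr_gt0//; lra.
have hE : 4 * h * (2 * m - 1) = m - 1 by rewrite /h; field; rewrite lt0r_neq0//; lra.
have h1 : h < 1 by rewrite ltr_pdivrMr; lra.
have := schwarz_taylor2_circle w b1 b2 e (1 - h) aw wU T2 ltac:(lra) e1.
rewrite -/m; set q := (1 - h) ^+ 4.
have q4 : 1 - 4 * h <= q by rewrite /q; nra.
nra.
Qed.

End taylor2.

(** * Power series near 0 *)

Section power_series.
Context {R : realType}.
Local Notation C := (R[i])^o.
Implicit Types (c : nat -> C) (S : C -> C) (z v : C).

Lemma cvgC_seqP (u : nat -> C) v : (u n @[n --> \oo] --> v)%classic <->
  forall e : R, 0 < e -> exists N, forall n, (N <= n)%N -> normc (v - u n) <= e.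
Proof.
split=> [/cvgrPdist_le H e e0|H].
  have := H e%:C; rewrite ltcR => /(_ e0) [N _ HN].
  by exists N => n /HN; rewrite norm_normc lecR.
apply: (proj2 (@cvgrPdist_le _ C nat \oo%classic _ u v)) => e.
rewrite ltcE => /andP[/eqP eI /H[N HN]].
by exists N => // n /HN; rewrite norm_normc lecE /= eI eqxx.
Qed.

Lemma limC_normc_le (u : nat -> C) v (q : R) :
  (forall e : R, 0 < e -> exists N, forall n, (N <= n)%N -> normc (v - u n) <= e) ->
  (forall n, normc (u n) <= q) -> normc v <= q.
Proof.
move=> H uq; apply/ler_addgt0Pl => e e0; have [N /(_ _ (leqnn N)) HN] := H _ e0.
by rewrite -(subrK (u N) v); apply: le_trans (le_normcD _ _) (lerD HN (uq _)).
Qed.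

Lemma normc_sum (F : nat -> C) (g : nat -> R) n :
  (forall k, normc (F k) <= g k) -> normc (\sum_(0 <= k < n) F k) <= \sum_(0 <= k < n) g k.
Proof.
move=> Fg; elim: n => [|n IH]; first by rewrite !big_nil normc0.
by rewrite !big_nat_recr //=; apply: le_trans (le_normcD _ _) (lerD IH (Fg n)).
Qed.

Lemma sum_half n : \sum_(0 <= k < n) (1 / 2 : R) ^+ k <= 2.
Proof.
have -> : \sum_(0 <= k < n) (1 / 2 : R) ^+ k = 2 - 2 * (1 / 2) ^+ n.
  elim: n => [|n IH]; first by rewrite big_nil expr0; ring.
  by rewrite big_nat_recr //= IH exprS; field.
by rewrite gerBl mulr_ge0// exprn_ge0// divr_ge0.
Qed.

Lemma complex_series_cvg (u : nat -> C) (q : R) :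
  (forall k, normc (u k) <= q * (1 / 2) ^+ k) ->
  exists v, (\sum_(0 <= k < n) u k @[n --> \oo] --> v)%classic.
Proof.
move=> uq.
have cg : cvgn (series (geometric q (1 / 2 : R))).
  by apply: is_cvg_geometric_series; rewrite ger0_norm; lra.
have cvgr (g : nat -> R) : (forall k, `|g k| <= normc (u k)) -> cvgn (series g).
  move=> gu; apply: normed_cvg; apply: series_le_cvg cg => k //=.
    by apply: le_trans (uq k); apply: normc_ge0.
  exact: le_trans (gu k) (uq k).
have /cvg_ex[/= x Hx] := cvgr (fun k => complex.Re (u k)) (fun k => Re_le_normc (u k)).
have /cvg_ex[/= y Hy] := cvgr (fun k => complex.Im (u k)) (fun k => Im_le_normc (u k)).
exists (x +i* y); apply/cvgC_seqP => e e0.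
move/cvgrPdist_le: Hx => /(_ (e / 2) (divr_gt0 e0 (ltr0n _ 2)))[N1 _ H1].
move/cvgrPdist_le: Hy => /(_ (e / 2) (divr_gt0 e0 (ltr0n _ 2)))[N2 _ H2].
exists (maxn N1 N2) => n; rewrite geq_max => /andP[n1 n2].
have sE : \sum_(0 <= k < n) u k =
    (\sum_(0 <= k < n) complex.Re (u k)) +i* (\sum_(0 <= k < n) complex.Im (u k)).
  elim: (n) => [|m IH]; first by rewrite !big_nil.
  by rewrite !big_nat_recr //= IH; case: (u m).
rewrite sE; apply: le_trans (normc_le_ReIm _) _ => /=.
have := lerD (H1 _ n1) (H2 _ n2); rewrite /series /=; lra.
Qed.

(** A quantitative form of a positive radius of convergence. *)
Definition geometric_bound c (A M : R) :=
  [/\ 0 <= A, 0 < M & forall n, normc (c n) <= A * M ^+ n].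

Lemma has_series_ex c A M z : geometric_bound c A M -> M * normc z <= 1 / 2 ->
  exists v, has_series c z v.
Proof.
move=> [A0 M0 cA] Mz; apply: (@complex_series_cvg _ A) => k.
rewrite normcM normcX; apply: le_trans (ler_wpM2r _ (cA k)) _.
  by rewrite exprn_ge0// normc_ge0.
rewrite -mulrA ler_wpM2l// -exprMn; apply: lerXn2r => //; rewrite nnegrE.
  by rewrite mulr_ge0 ?normc_ge0// ltW.
by lra.
Qed.

(** Convergence at the single point [rho / 2] bounds the terms there, and [M] is the inverse of its
    modulus. *)
Lemma has_series_geometric_bound c (rho : R) : 0 < rho ->
  (forall z, normc z < rho -> exists v, has_series c z v) ->
  exists A M, geometric_bound c A M.
Proof.
move=> rho0 H; pose z0 : C := (rho / 2)%:C.
have nz0 : normc z0 = rho / 2 by rewrite normcR ger0_norm//; lra.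
have [v /cvgC_seqP Hv] : exists v, has_series c z0 v by apply: H; rewrite nz0; lra.
have [N HN] := Hv _ ltr01.
pose t k := normc (c k * z0 ^+ k).
(* A late term is the difference of two partial sums, each within 1 of the limit; the finitely many
   early terms are covered by adding them all. *)
have tN k : (N <= k)%N -> t k <= 2.
  move=> Nk; have h1 := HN k.+1 (leqW Nk); have h2 := HN k Nk.
  rewrite big_nat_recr //= in h1; rewrite /t.
  set s := \sum_(_ <= _ < _) _ in h1 h2.
  have -> : c k * z0 ^+ k = (v - s) + - (v - (s + c k * z0 ^+ k)) :> R[i] by ring.
  apply: le_trans (le_normcD _ _) _; rewrite normcN; lra.
have tA k : t k <= 2 + \sum_(0 <= j < N) t j.
  have t0 j : 0 <= t j by apply: normc_ge0.
  have [/tN tk|kN] := leqP N k; first by rewrite ler_wpDr// sumr_ge0.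
  by rewrite (bigD1_seq k) ?mem_index_iota ?iota_uniq//= addrCA lerDl addr_ge0// sumr_ge0.
exists (2 + \sum_(0 <= j < N) t j), (2 / rho); split.
- by rewrite addr_ge0// sumr_ge0// => j _; apply: normc_ge0.
- by rewrite divr_gt0.
move=> n; have := tA n; rewrite /t normcM normcX nz0.
have -> : (2 / rho) ^+ n = ((rho / 2) ^+ n)^-1 by rewrite -exprVn invf_div.
by rewrite ler_pdivlMr// exprn_gt0// divr_gt0.
Qed.

Definition series_near0 c S :=
  exists2 rho : R, 0 < rho & forall z, normc z < rho -> has_series c z (S z).

Definition diff_coef c : nat -> C := fun n => n.+1%:R * c n.+1.

Lemma leq_sqr_4exp n : (n ^ 2 <= 4 ^ n)%N.
Proof. by rewrite -[4%N]/(2 ^ 2)%N -expnM mulnC expnM leq_exp2r// ltnW// ltn_expl. Qed.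

(** Induction on [k]: the remainder is multiplied by [z + h] and gains [h ^+ 2 * (k * z ^+ k.-1)],
    and [k ^ 2 + k] is at most the next square. The factor [rho ^+ 2] on the left avoids the
    exponent [k - 2]. *)
Lemma binomial_remainder (rho : R) (z h : C) k : 0 <= rho ->
  normc z <= rho -> normc (z + h) <= rho ->
  rho ^+ 2 * normc ((z + h) ^+ k - z ^+ k - h * (k%:R * z ^+ k.-1))
    <= normc h ^+ 2 * ((k ^ 2)%:R * rho ^+ k).
Proof.
move=> rho0 zr zhr; elim: k => [|k IH].
  by rewrite !expr0 subrr !mul0r mulr0 subr0 normc0 mulr0 mulr0.
set T := _ - _ in IH.
have -> : (z + h) ^+ k.+1 - z ^+ k.+1 - h * (k.+1%:R * z ^+ k) =
    (z + h) * T + h ^+ 2 * (k%:R * z ^+ k.-1).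
  rewrite /T; case: (k) => [|m]; first by rewrite !expr0 !expr1; ring.
  by rewrite /= -natr1 !exprS; ring.
have B : rho ^+ 2 * (k%:R * normc (z ^+ k.-1)) <= k%:R * rho ^+ k.+1.
  case: (k) => [|m]; first by rewrite !mul0r mulr0.
  rewrite /= mulrCA ler_wpM2l// normcX -(addn2 m) exprD mulrC.
  rewrite ler_wpM2r ?sqr_ge0//; apply: lerXn2r => //; rewrite nnegrE ?normc_ge0//.
have kn : normc (k%:R : C) = k%:R.
  by rewrite -[k%:R : C](rmorph_nat (real_complex R)) normcR ger0_norm.
have D : rho ^+ 2 * normc ((z + h) * T) <= rho * (normc h ^+ 2 * ((k ^ 2)%:R * rho ^+ k)).
  rewrite normcM mulrCA; apply: ler_pM => //; first exact: normc_ge0.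
  by rewrite mulr_ge0 ?sqr_ge0 ?normc_ge0.
have E : rho ^+ 2 * normc (h ^+ 2 * (k%:R * z ^+ k.-1)) <= normc h ^+ 2 * (k%:R * rho ^+ k.+1).
  by rewrite !normcM kn !normcX -expr2 mulrCA ler_wpM2l ?sqr_ge0// -normcX.
apply: le_trans (ler_wpM2l (sqr_ge0 _) (le_normcD _ _)) _; rewrite mulrDr.
apply: le_trans (lerD D E) _.
have -> : rho * (normc h ^+ 2 * ((k ^ 2)%:R * rho ^+ k)) + normc h ^+ 2 * (k%:R * rho ^+ k.+1)
  = normc h ^+ 2 * ((k ^ 2 + k)%:R * rho ^+ k.+1) by rewrite natrD (exprS rho k); ring.
rewrite ler_wpM2l ?sqr_ge0// ler_wpM2r ?exprn_ge0// ler_nat.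
by rewrite !expnS !expn0; lia.
Qed.

Lemma diff_coef_bound c A M : geometric_bound c A M ->
  geometric_bound (diff_coef c) (A * M) (2 * M).
Proof.
move=> [A0 M0 cA]; split; [by rewrite mulr_ge0// ltW|by rewrite mulr_gt0|move=> n].
have -> : A * M * (2 * M) ^+ n = 2 ^+ n * (A * M ^+ n.+1) by rewrite exprMn exprS; ring.
rewrite /diff_coef normcM; apply: ler_pM; rewrite ?normc_ge0 ?cA//.
rewrite -[n.+1%:R : C](rmorph_nat (real_complex R)) normcR ger0_norm//.
by rewrite -natrX ler_nat ltn_expl.
Qed.

(** The termwise remainders are dominated by a geometric series of ratio 1/2, since [k ^ 2 <= 4 ^ k]
    and [4 * M * rho <= 1 / 2]; hence a bound uniform in [n]. The derived sum has one term less
    because the constant term disappears. *)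
Lemma partial_sum_remainder c (A M rho : R) (z h : C) n : geometric_bound c A M ->
  0 < rho -> 4 * M * rho <= 1 / 2 -> normc z <= rho -> normc (z + h) <= rho ->
  normc (\sum_(0 <= k < n.+1) c k * (z + h) ^+ k - \sum_(0 <= k < n.+1) c k * z ^+ k
    - h * \sum_(0 <= k < n) diff_coef c k * z ^+ k) <= 2 * (A / rho ^+ 2) * normc h ^+ 2.
Proof.
move=> [A0 M0 cA] rho0 Mr zr zhr.
pose T k := (z + h) ^+ k - z ^+ k - h * (k%:R * z ^+ k.-1).
have -> : \sum_(0 <= k < n.+1) c k * (z + h) ^+ k - \sum_(0 <= k < n.+1) c k * z ^+ k
    - h * \sum_(0 <= k < n) diff_coef c k * z ^+ k = \sum_(0 <= k < n.+1) c k * T k.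
  have -> : \sum_(0 <= k < n) diff_coef c k * z ^+ k =
      \sum_(0 <= k < n.+1) c k * (k%:R * z ^+ k.-1).
    rewrite big_nat_recl //= mul0r mulr0 add0r; apply: eq_bigr => k _.
    by rewrite /diff_coef; ring.
  rewrite mulr_sumr -!sumrB; apply: eq_bigr => k _; rewrite /T; ring.
pose g k := A / rho ^+ 2 * normc h ^+ 2 * (1 / 2) ^+ k.
have Tg k : normc (c k * T k) <= g k.
  have r2 : 0 < rho ^+ 2 by rewrite exprn_gt0.
  rewrite normcM -(ler_pM2l r2) mulrCA.
  apply: le_trans (ler_pM (normc_ge0 _) _ (cA k) (binomial_remainder _ _ _ k (ltW rho0) zr zhr)) _.
    by rewrite mulr_ge0 ?normc_ge0// ltW.
  have -> : rho ^+ 2 * g k = normc h ^+ 2 * (A * (1 / 2) ^+ k).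
    by rewrite /g; field; rewrite lt0r_neq0.
  rewrite mulrCA ler_wpM2l ?sqr_ge0// -mulrA ler_wpM2l//.
  apply: le_trans (_ : (4 * M * rho) ^+ k <= _); last first.
    by apply: lerXn2r; rewrite ?nnegrE// ?mulr_ge0 ?divr_ge0 ?ltW.
  have -> : (4 * M * rho) ^+ k = M ^+ k * ((4 ^ k)%:R * rho ^+ k).
    by rewrite !exprMn natrX; ring.
  have M0' := ltW M0; have rho0' := ltW rho0.
  by rewrite ler_wpM2l ?exprn_ge0// ler_wpM2r ?exprn_ge0// ler_nat leq_sqr_4exp.
apply: le_trans (normc_sum _ _ _ Tg) _.
rewrite /g -mulr_sumr; apply: le_trans (ler_wpM2l _ (sum_half _)) _.
  by rewrite mulr_ge0 ?sqr_ge0// divr_ge0 ?sqr_ge0.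
by rewrite le_eqVlt; apply/orP; left; apply/eqP; ring.
Qed.

Lemma series_near0_remainder c S : series_near0 c S ->
  exists sigma Q, [/\ 0 < sigma, 0 <= Q &
    forall z, normc z <= sigma -> exists2 v, has_series (diff_coef c) z v &
      forall h, normc (z + h) <= sigma -> normc (S (z + h) - S z - h * v) <= Q * normc h ^+ 2].
Proof.
move=> [rho rho0 HS].
have [A [M cA]] : exists A M, geometric_bound c A M.
  by apply: (has_series_geometric_bound _ _ rho0) => z /HS; exists (S z).
have [A0 M0 _] := cA.
(* The first bound stays inside the disc of convergence; the second gives the
   [4 * M * sigma <= 1 / 2] asked by [partial_sum_remainder]. *)
pose sigma := Num.min (rho / 2) (1 / (8 * M)).
have s0 : 0 < sigma by rewrite lt_min !divr_gt0 ?mulr_gt0.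
have sr : sigma < rho.
  by rewrite /sigma; case: (leP (rho / 2) (1 / (8 * M))) => ?; lra.
have Ms : 8 * M * sigma <= 1.
  rewrite mulrC -ler_pdivlMr ?mulr_gt0// /sigma.
  by case: (leP (rho / 2) (1 / (8 * M))) => // /ltW.
exists sigma, (2 * (A / rho ^+ 2) + 2 * (A / sigma ^+ 2)); split => //.
  by rewrite addr_ge0// mulr_ge0// divr_ge0// sqr_ge0.
move=> z zs.
have [v Hv] : exists v, has_series (diff_coef c) z v.
  apply: (has_series_ex _ _ _ _ (diff_coef_bound _ _ _ cA)).
  have := ler_wpM2l (ltW M0) zs; lra.
exists v => // h zhs.
apply: (le_trans (y := 2 * (A / sigma ^+ 2) * normc h ^+ 2)); last first.
  by rewrite ler_wpM2r ?sqr_ge0// lerDr mulr_ge0// divr_ge0// sqr_ge0.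
apply: (@limC_normc_le (fun n =>
   \sum_(0 <= k < n.+1) c k * (z + h) ^+ k - \sum_(0 <= k < n.+1) c k * z ^+ k
    - h * \sum_(0 <= k < n) diff_coef c k * z ^+ k)); last first.
  by move=> n; apply: (partial_sum_remainder _ _ _ _ _ _ _ cA) => //; lra.
move=> e e0.
have e3 : 0 < e / 3 by lra.
have nh : 0 < normc h + 1 by rewrite ltr_wpDl ?normc_ge0.
have eh : 0 < e / 3 / (normc h + 1) by rewrite divr_gt0.
have /cvgC_seqP/(_ _ e3)[N1 H1] := HS (z + h) (le_lt_trans zhs sr).
have /cvgC_seqP/(_ _ e3)[N2 H2] := HS z (le_lt_trans zs sr).
have /cvgC_seqP/(_ _ eh)[N3 H3] := Hv.
exists (maxn N1 (maxn N2 N3)) => n; rewrite !geq_max => /and3P[n1 n2 n3].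
move: (H1 _ (leqW n1)) (H2 _ (leqW n2)) (H3 _ n3).
set s1 := \sum_(_ <= _ < _) _; set s2 := \sum_(_ <= _ < _) _; set s3 := \sum_(_ <= _ < _) _.
move=> h1 h2 h3.
have -> : S (z + h) - S z - h * v - (s1 - s2 - h * s3) =
  (S (z + h) - s1) + - (S z - s2) + - (h * (v - s3)) :> R[i] by ring.
apply: le_trans (le_normcD _ _) _; rewrite normcN normcM.
have {nh eh} h4 : normc h * normc (v - s3) <= e / 3.
  apply: le_trans (ler_wpM2l (normc_ge0 _) h3) _.
  by rewrite mulrCA ler_piMr ?(ltW e3)// ler_pdivrMr// mul1r lerDl.
have eE : e = e / 3 + e / 3 + e / 3 by field.
rewrite eE; apply: lerD h4; apply: le_trans (le_normcD _ _) (lerD h1 _).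
by rewrite normcN.
Qed.

(** A quadratic remainder at each point near 0 identifies the derivative with the derived series.
    The conclusion has the form of the hypothesis, so it can be iterated to reach the second
    derivative. *)
Lemma series_near0_derive c S : series_near0 c S ->
  series_near0 (diff_coef c) (derive1 S) /\ \forall z \near (0 : C), derivable S z 1.
Proof.
move=> /series_near0_remainder[sigma [Q [s0 Q0 H]]].
have D z : normc z < sigma -> exists2 v, has_series (diff_coef c) z v &
    is_derive z 1 S v.
  move=> zs; have [v Hv Hr] := H z (ltW zs); exists v; first exact: Hv.
  apply/is_deriveC_P => e e0.
  exists (Num.min (sigma - normc z) (e / (Q + 1))).
    by rewrite lt_min subr_gt0 zs divr_gt0// ltr_wpDl.
  move=> h; rewrite lt_min => /andP[h1 h2]; rewrite (mulrC v).
  have /Hr hr : normc (z + h) <= sigma by apply: le_trans (le_normcD _ _) _; lra.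
  apply: le_trans hr _; rewrite expr2 mulrA ler_wpM2r ?normc_ge0//.
  move: h2; rewrite ltr_pdivlMr ?ltr_wpDl// => /ltW; apply: le_trans.
  by rewrite mulrC ler_wpM2l ?normc_ge0// lerDl.
split; last by apply/near_complexP; exists sigma => // z; rewrite subr0 => /D[v _ []].
by exists sigma => // z /D[v Hv [_ Dv]]; rewrite derive1E Dv.
Qed.

Lemma series_near0_taylor2 c S : series_near0 c S -> taylor2 S (c 0%N) (c 1%N) (c 2%N).
Proof.
move=> [rho rho0 HS].
have [A [M cA]] : exists A M, geometric_bound c A M.
  by apply: (has_series_geometric_bound _ _ rho0) => z /HS; exists (S z).
have [A0 M0 cM] := cA; pose Q := 2 * (A * M ^+ 3).
have M0' := ltW M0.
have Q0 : 0 <= Q by rewrite mulr_ge0// mulr_ge0// exprn_ge0.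
have B z : normc z < rho -> M * normc z <= 1 / 2 ->
    normc (S z - (c 0%N + c 1%N * z + c 2%N * z ^+ 2)) <= Q * normc z ^+ 3.
  move=> zr zM.
  (* The tail after three terms is summed with indices shifted by 3, which brings out the factor
     [normc z ^+ 3]. *)
  apply: (@limC_normc_le (fun n => \sum_(0 <= k < n) c k.+3 * z ^+ k.+3)); last first.
    move=> n; pose g k := A * M ^+ 3 * normc z ^+ 3 * (1 / 2) ^+ k.
    have cg k : normc (c k.+3 * z ^+ k.+3) <= g k.
      rewrite normcM normcX; apply: le_trans (ler_wpM2r _ (cM _)) _.
        by rewrite exprn_ge0// normc_ge0.
      rewrite /g -(addn3 k) !exprD.
      have -> : A * (M ^+ k * M ^+ 3) * (normc z ^+ k * normc z ^+ 3) =
         A * M ^+ 3 * normc z ^+ 3 * ((M * normc z) ^+ k) by rewrite exprMn; ring.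
      rewrite ler_wpM2l ?mulr_ge0 ?exprn_ge0 ?normc_ge0//.
      by apply: lerXn2r; rewrite ?nnegrE// ?mulr_ge0 ?divr_ge0 ?normc_ge0 ?ltW.
    apply: le_trans (normc_sum _ _ _ cg) _.
    rewrite /g -mulr_sumr; apply: le_trans (ler_wpM2l _ (sum_half _)) _.
      by rewrite !mulr_ge0 ?exprn_ge0 ?normc_ge0.
    by rewrite /Q le_eqVlt; apply/orP; left; apply/eqP; ring.
  move=> e e0; have /cvgC_seqP/(_ _ e0)[N HN] := HS z zr.
  exists N => n nN; have := HN n.+3 (leqW (leqW (leqW nN))).
  rewrite !big_nat_recl //= expr0 expr1.
  set s := \sum_(_ <= _ < _) _.
  suff -> : S z - (c 0%N * 1 + (c 1%N * z + (c 2%N * z ^+ 2 + s))) =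
    S z - (c 0%N + c 1%N * z + c 2%N * z ^+ 2) - s :> R[i] by [].
  ring.
have S0 : S 0 = c 0%N.
  have := B 0; rewrite normc0 rho0 mulr0 divr_ge0// => /(_ isT isT).
  rewrite !expr0n /= !mulr0 !addr0 => h; apply/eqP; rewrite -subr_eq0; apply/eqP.
  by apply: eq0_normc; apply/le_anti/andP; split; [exact: h|exact: normc_ge0].
exists (fun z => if z == 0 then c 2%N else (S z - c 0%N - c 1%N * z) / z ^+ 2).
split; last first.
- apply/near_complexP; exists 1 => // z _.
  by have [->|z0] := eqVneq z 0; [rewrite expr0n !mulr0 mul0r !addr0|field].
- by rewrite eqxx.
apply/continuousC_P => e e0; rewrite eqxx.
exists (Num.min rho (Num.min (1 / (2 * M)) (e / (Q + 1)))).
  by rewrite !lt_min rho0 !divr_gt0 ?mulr_gt0// ltr_wpDl.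
move=> z; rewrite subr0 !lt_min => /and3P[z1 z2 z3].
case: eqVneq => [_|z0]; first by rewrite subrr normc0 ltW.
have nz : 0 < normc z by rewrite normc_gt0.
have -> : (S z - c 0%N - c 1%N * z) / z ^+ 2 - c 2%N =
   (S z - (c 0%N + c 1%N * z + c 2%N * z ^+ 2)) / z ^+ 2 :> R[i] by field.
rewrite normcM normcV normcX ler_pdivrMr ?exprn_gt0//.
have zM : M * normc z <= 1 / 2.
  by move: z2; rewrite ltr_pdivlMr ?mulr_gt0//; lra.
apply: le_trans (B z z1 zM) _; rewrite exprS mulrA ler_wpM2r ?sqr_ge0//.
move: z3; rewrite ltr_pdivlMr ?ltr_wpDl// => /ltW; apply: le_trans.
by rewrite mulrC ler_wpM2l ?normc_ge0// lerDl.
Qed.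

End power_series.

(** * Inverse functions and coefficient bounds *)

Section inverse_derivatives.
Context {K : numFieldType}.
Implicit Types (f g : K^o -> K^o).

Lemma derive1_fcomp f g (x : K^o) : derivable g x 1 -> derivable f (g x) 1 ->
  derivable (fun w => f (g w)) x 1 /\
  derive1 (fun w => f (g w)) x = derive1 f (g x) * derive1 g x.
Proof.
move=> /derivable1_diffP dg /derivable1_diffP df.
have dfg : differentiable (f \o g) x by apply: differentiable_comp.
split; first by apply/derivable1_diffP.
rewrite -[LHS]/(derive1 (f \o g) x) derive1E'// diff_comp// !derive1E'//=.
by rewrite -[X in 'd  _ _ X = _]mulr1 [LHS]linearZ mulrC.
Qed.

Lemma derive1_near_eq f g (x : K^o) : (\forall y \near x, f y = g y) ->
  derive1 f x = derive1 g x.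
Proof. by move=> fg; rewrite !derive1E; apply: near_eq_derive. Qed.

(** Differentiating an identity at [w] requires it on a neighbourhood of [w], not only at points
    near 0. *)
Lemma near0_join {P : K^o -> Prop} : (\forall w \near (0 : K^o), P w) ->
  \forall w \near (0 : K^o), \forall w' \near w, P w'.
Proof. exact: nbhs_interior. Qed.

(** The identity [f (g w) = w] is differentiated once, and the resulting formula for [derive1 g]
    once more. *)
Lemma inverse_derivatives f g :
  (\forall w \near (0 : K^o), f (g w) = w) ->
  (\forall z \near (0 : K^o), derivable f z 1) ->
  (\forall z \near (0 : K^o), derivable (derive1 f) z 1) ->
  (\forall w \near (0 : K^o), derivable g w 1) ->
  continuous_at (0 : K^o) g -> g 0 = 0 ->
  continuous_at (0 : K^o) (derive1 f) -> derive1 f 0 != 0 ->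
  \forall w \near (0 : K^o), [/\ derive1 f (g w) != 0,
    derive1 g w = (derive1 f (g w))^-1 &
    derive1 (derive1 g) w = - derive1 (derive1 f) (g w) / derive1 f (g w) ^+ 3].
Proof.
move=> fg df ddf dg cg g0 cf f10.
have df' := near0_comp cg g0 df; have ddf' := near0_comp cg g0 ddf.
have nz := near0_comp cg g0 (near_neq0 cf f10).
have E1 : \forall w \near (0 : K^o), derive1 g w = (derive1 f (g w))^-1.
  apply: near0_imp2 (filterI (near0_join fg) dg) (filterI df' nz).
  move=> w [fgw dgw] [dfw nzw].
  have [_] := derive1_fcomp f g w dgw dfw; rewrite (derive1_near_eq _ (fun w => w) w fgw).
  rewrite [LHS]derive1E derive_id => E.
  by apply: (mulfI nzw); rewrite -E divff.
apply: near0_imp2 (filterI (near0_join E1) (filterI E1 dg)) (filterI ddf' nz).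
move=> w [E1w [E1' dgw]] [ddfw nzw]; split=> //.
have [dc Dc] := derive1_fcomp (derive1 f) g w dgw ddfw.
rewrite (derive1_near_eq _ _ w E1w) derive1E deriveV// -derive1E Dc E1'.
by rewrite -[_ *: _]/(_ * _); field.
Qed.

Lemma taylor2_inverse_Gop {f g l a2 a3 x} :
  taylor2 (derive1 f) 1 (2 * a2) (3 * a3) ->
  taylor2 (derive1 (derive1 f)) (2 * a2) (6 * a3) x ->
  taylor2 g 0 1 (- a2) ->
  (\forall w \near (0 : K^o), f (g w) = w) ->
  (\forall z \near (0 : K^o), derivable f z 1) ->
  (\forall z \near (0 : K^o), derivable (derive1 f) z 1) ->
  (\forall w \near (0 : K^o), derivable g w 1) ->
  taylor2 (fun w => (1 - l) * derive1 g w
      + l * (1 + w * derive1 (derive1 g) w / derive1 g w))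
    1 (- (2 * a2)) (3 * (1 + l) * (2 * a2 ^+ 2 - a3) - 4 * l * a2 ^+ 2).
Proof.
move=> T1 T2 Tg fg df ddf dg.
apply: (taylor2_near_eq _ (taylor2_Gop_inverse T1 T2 Tg)).
have f10 : derive1 f 0 != 0 by rewrite (taylor2_0 _ T1) oner_neq0.
have := inverse_derivatives _ _ fg df ddf dg (taylor2_continuous Tg) (taylor2_0 _ Tg)
  (taylor2_continuous T1) f10.
move=> H; apply: (near0_imp2 _ H H) => w [F10 g1 g2] _; rewrite g1 g2.
by field.
Qed.

End inverse_derivatives.

(** * From subordination to inequalities between coefficients *)

Section coefficient_bounds.
Context {R : realType}.
Local Notation C := (R[i])^o.

Lemma near0_inU : \forall z \near (0 : C), inU z.
Proof. by apply/near_complexP; exists 1 => // z; rewrite subr0 => /inUE. Qed.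

(** The two normed quantities are the first two coefficients of the Schwarz function, found by
    [taylor2_root] and bounded by [schwarz_taylor2]. *)
Lemma subord_coef_bound (phi h : C -> C) (p1 p2 c1 c2 : C) : p1 != 0 ->
  taylor2 phi 1 p1 p2 -> taylor2 h 1 c1 c2 -> subord h phi ->
  normc (c1 / p1) ^+ 2 + normc ((c2 - p2 * (c1 / p1) ^+ 2) / p1) <= 1.
Proof.
move=> p10 Tphi Th [w [aw w0 wU hw]].
apply: (schwarz_taylor2 w) => //.
have inU0 : inU (0 : C) by apply/inUE; rewrite normc0.
apply: (taylor2_root p10 Tphi Th (derivableC_continuous _ _ (aw _ inU0)) w0).
by apply: near0_imp2 near0_inU near0_inU => z zU _; rewrite hw.
Qed.

(** The left inverse is also a right one: [g (f (g w)) = g w], and [g] is injective on the disc,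
    which contains both [f (g w)] and [w] for small [w]. *)
Lemma right_inverse_near0 (f g : C -> C) : inverse_ext f g -> f 0 = 0 ->
  continuous_at (0 : C) f ->
  [/\ g 0 = 0, continuous_at (0 : C) g, (\forall w \near (0 : C), derivable g w 1) &
      \forall w \near (0 : C), f (g w) = w].
Proof.
move=> [[ag gi] gf] f0 cf.
have g0 : g 0 = 0 by rewrite -{1}f0 (nbhs_singleton gf).
have inU0 : inU (0 : C) by apply/inUE; rewrite normc0.
have cg := derivableC_continuous _ _ (ag _ inU0).
split=> //; first by apply: near0_imp2 near0_inU near0_inU => z zU _; apply: ag.
have fgU : \forall w \near (0 : C), inU (f (g w)).
  exact: (near0_comp cg g0 (near0_comp cf f0 near0_inU)).
apply: near0_imp2 (filterI near0_inU fgU) (near0_comp cg g0 gf).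
by move=> w [wU fgwU] gfg; apply: gi.
Qed.

(** Here [b] and [- b] are the first, [x] and [y] the second coefficients of the two Schwarz
    functions. Adding the two relations eliminates [a3] and bounds [b]; subtracting them isolates
    [a3 - a2 ^+ 2]. *)
Lemma coef_bounds (lam B1 B2 : R) (a2 a3 : R[i]) : 0 <= lam <= 1 -> 0 < B1 ->
  normc (2 * a2 / B1%:C) ^+ 2 +
    normc ((3 * (1 + lam%:C) * a3 - 4 * lam%:C * a2 ^+ 2
            - B2%:C * (2 * a2 / B1%:C) ^+ 2) / B1%:C) <= 1 ->
  normc (- (2 * a2) / B1%:C) ^+ 2 +
    normc ((3 * (1 + lam%:C) * (2 * a2 ^+ 2 - a3) - 4 * lam%:C * a2 ^+ 2
            - B2%:C * (- (2 * a2) / B1%:C) ^+ 2) / B1%:C) <= 1 ->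
  let D := 4 * B1 + `|(3 - lam) * B1 ^+ 2 - 4 * B2| in
  normc a2 ^+ 2 <= B1 ^+ 3 / D /\
  normc a3 <= normc a2 ^+ 2 + B1 / (3 * (1 + lam)) * (1 - 4 * normc a2 ^+ 2 / B1 ^+ 2).
Proof.
move=> /andP[l0 l1] B10; have BC : B1%:C != 0 :> R[i] by rewrite eq_complex /= negb_and lt0r_neq0.
have B1n : B1 != 0 by rewrite lt0r_neq0.
rewrite mulNr normcN sqrrN.
set b := 2 * a2 / B1%:C; set x := _ / B1%:C; set y := _ / B1%:C => Hx Hy D.
have bE : a2 = b * (B1 / 2)%:C.
  rewrite /b rmorphM fmorphV /= rmorph_nat; field; by rewrite BC.
have na2 : normc a2 = normc b * (B1 / 2) by rewrite {1}bE normcM normcR ger0_norm//; lra.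
set t := normc b ^+ 2 in Hx Hy.
have na2E : normc a2 ^+ 2 = B1 ^+ 2 * t / 4 by rewrite na2 /t; field.
have D0 : 0 < D by rewrite /D ltr_pwDl// mulr_gt0.
have sumxy : normc ((x + y) * (2 * B1)%:C) <= 2 * (1 - t) * (2 * B1).
  rewrite normcM normcR (ger0_norm (_ : 0 <= 2 * B1)); last by lra.
  rewrite ler_wpM2r//; first by lra.
  by apply: le_trans (le_normcD _ _) _; lra.
have sumE : (x + y) * (2 * B1)%:C = b ^+ 2 * ((3 - lam) * B1 ^+ 2 - 4 * B2)%:C.
  rewrite /x /y bE !(rmorphM, rmorphB, rmorphXn, rmorph_nat, fmorphV) /=.
  by field; rewrite BC.
have tD : t * D <= 4 * B1.
  by move: sumxy; rewrite sumE normcM normcX normcR -/t /D; lra.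
have diffE : a3 = a2 ^+ 2 + (x + - y) * (B1 / (6 * (1 + lam)))%:C.
  have lC : 1 + lam%:C != 0 :> R[i].
    by rewrite eq_complex /= negb_and lt0r_neq0//; lra.
  rewrite /x /y !(rmorphM, rmorphD, rmorphXn, rmorph_nat, fmorphV, rmorph1) /=.
  by field; rewrite BC lC.
split.
  by rewrite na2E ler_pdivlMr// exprS; nra.
rewrite {1}diffE; apply: le_trans (le_normcD _ _) _; rewrite normcX lerD2l.
have l10 : 0 < 1 + lam by lra.
have k0 : 0 <= B1 / (6 * (1 + lam)) by rewrite divr_ge0 ?mulr_ge0// ltW.
rewrite normcM normcR ger0_norm// na2E.
have -> : B1 / (3 * (1 + lam)) * (1 - 4 * (B1 ^+ 2 * t / 4) / B1 ^+ 2) =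
   2 * (1 - t) * (B1 / (6 * (1 + lam))) by field; rewrite B1n lt0r_neq0.
rewrite ler_wpM2r//; apply: le_trans (le_normcD _ _) _; rewrite normcN; lra.
Qed.

End coefficient_bounds.

(** * Expansions of the operator at [f] and at its inverse *)

Section Gop_expansions.
Context {R : realType}.
Local Notation C := (R[i])^o.
Variables (f : C -> C) (a : nat -> R[i]).
Hypotheses (a0 : a 0%N = 0) (a1 : a 1%N = 1) (fa : series_near0 a f).

Lemma taylor2_normalized : taylor2 f 0 1 (a 2%N).
Proof. by have := series_near0_taylor2 _ _ fa; rewrite a0 a1. Qed.

Lemma taylor2_derive1 : taylor2 (derive1 f) 1 (2 * a 2%N) (3 * a 3%N).
Proof.
have [S1 _] := series_near0_derive _ _ fa.
by have := series_near0_taylor2 _ _ S1; rewrite /diff_coef a1 mulr1.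
Qed.

(** The operator multiplies the second derivative by its variable, so only the first two
    coefficients are made explicit; [x] is [12 * a 4]. *)
Lemma taylor2_derive2 : exists x,
  taylor2 (derive1 (derive1 f)) (2 * a 2%N) (6 * a 3%N) x.
Proof.
have [S1 _] := series_near0_derive _ _ fa.
have [S2 _] := series_near0_derive _ _ S1.
exists (diff_coef (diff_coef a) 2).
apply: (taylor2_eq (series_near0_taylor2 _ _ S2)) => //; rewrite /diff_coef; ring.
Qed.

Lemma taylor2_Gop_series lam : taylor2 (Gop lam f) 1 (2 * a 2%N)
  (3 * (1 + lam%:C) * a 3%N - 4 * lam%:C * a 2%N ^+ 2).
Proof.
have [x T2] := taylor2_derive2.
exact: (taylor2_Gop (l := lam%:C) taylor2_derive1 T2).
Qed.

Lemma taylor2_Gop_series_inverse lam (g : C -> C) : f 0 = 0 -> inverse_ext f g ->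
  taylor2 (Gop lam g) 1 (- (2 * a 2%N))
    (3 * (1 + lam%:C) * (2 * a 2%N ^+ 2 - a 3%N) - 4 * lam%:C * a 2%N ^+ 2).
Proof.
move=> f0 gext; have [x T2] := taylor2_derive2; have T1 := taylor2_derive1.
have [S1 df] := series_near0_derive _ _ fa; have [_ ddf] := series_near0_derive _ _ S1.
have [g0 cg dg fg] := right_inverse_near0 _ _ gext f0 (taylor2_continuous taylor2_normalized).
have Tg : taylor2 g 0 1 (- a 2%N).
  apply: (taylor2_eq (taylor2_root (oner_neq0 _) taylor2_normalized taylor2_id cg g0 fg)) => //.
    by rewrite divr1.
  by rewrite !divr1 expr1n mulr1 sub0r.
exact: (taylor2_inverse_Gop (l := lam%:C) T1 T2 Tg fg df ddf dg).
Qed.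

End Gop_expansions.

Theorem theorem2p1 (R : realType) (lam : R) (phi : (R[i])^o -> (R[i])^o) (B : nat -> R)
  (f : (R[i])^o -> (R[i])^o) (a : nat -> R[i]) :
  0 <= lam <= 1 ->
  phi_hyp phi B ->
  a 0%N = 0 -> a 1%N = 1 ->
  (forall z, inU z -> has_series a z (f z)) ->
  G_class lam phi f ->
  let D := 4 * B 1%N + `|(3 - lam) * B 1%N ^+ 2 - 4 * B 2%N| in
  `|a 2%N| <= (B 1%N * Num.sqrt (B 1%N) / Num.sqrt D)%:C /\
  `|a 3%N| <=
    (if 4 / (3 * (1 + lam)) <= B 1%N
     then (1 - 4 / (3 * (1 + lam) * B 1%N)) * B 1%N ^+ 3 / D + B 1%N / (3 * (1 + lam))
     else B 1%N / (3 * (1 + lam)))%:C.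
Proof.
move=> lam01 [_ _ _ [Bphi B0 B10]] a0 a1 fa [[_ f0 _ _] [g [gext sf sg]]] D.
have near0_series c (S : (R[i])^o -> (R[i])^o) :
    (forall z, inU z -> has_series c z (S z)) -> series_near0 c S.
  by move=> cS; exists 1 => // z z1; apply/cS/inUE.
have Tphi := series_near0_taylor2 _ _ (near0_series _ _ Bphi); rewrite B0 in Tphi.
have Bn0 : (B 1%N)%:C != 0 :> R[i] by rewrite eq_complex /= negb_and lt0r_neq0.
have Sf := near0_series _ _ fa.
have Hf := subord_coef_bound _ _ _ _ _ _ Bn0 Tphi (taylor2_Gop_series _ _ a1 Sf lam) sf.
have Hg := subord_coef_bound _ _ _ _ _ _ Bn0 Tphi
  (taylor2_Gop_series_inverse _ _ a0 a1 Sf lam g f0 gext) sg.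
have := coef_bounds lam (B 1%N) (B 2%N) (a 2%N) (a 3%N) lam01 B10 Hf Hg.
rewrite /= -/D => -[A2 A3].
have D0 : 0 < D by rewrite /D ltr_pwDl// mulr_gt0.
have B1n : B 1%N != 0 by rewrite lt0r_neq0.
have /andP[l0 _] := lam01; have l1 : 0 < 1 + lam by lra.
rewrite !norm_normc !lecR; split.
  rewrite -(ler_pXn2r (n := 2)) ?nnegrE ?normc_ge0//; last first.
    by rewrite divr_ge0 ?mulr_ge0 ?sqrtr_ge0// ltW.
  by rewrite expr_div_n exprMn !sqr_sqrtr ?(ltW B10) ?(ltW D0)// -exprSr.
apply: le_trans A3 _.
set m := normc (a 2%N) ^+ 2 in A2 *.
(* The bound is affine in [m], and the sign of its slope is the case distinction of the theorem: a
   nonnegative slope takes the upper bound [A2] on [m], a negative one takes [m >= 0]. *)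
have -> : m + B 1%N / (3 * (1 + lam)) * (1 - 4 * m / B 1%N ^+ 2) =
   (1 - 4 / (3 * (1 + lam) * B 1%N)) * m + B 1%N / (3 * (1 + lam)).
  by field; rewrite B1n lt0r_neq0.
have kE : (0 <= 1 - 4 / (3 * (1 + lam) * B 1%N)) = (4 / (3 * (1 + lam)) <= B 1%N).
  by rewrite subr_ge0 ler_pdivrMr ?mulr_gt0// mul1r ler_pdivrMr ?mulr_gt0// mulrC.
rewrite -kE; have [k0|k0] := leP 0 (1 - 4 / (3 * (1 + lam) * B 1%N)).
  by rewrite lerD2r -[leRHS]mulrA ler_wpM2l.
by rewrite gerDr mulr_le0_ge0 ?sqr_ge0// ltW.
Qed.
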